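(* Assume periodic boundary conditions, and assume that the Euler scheme $\texttt{euler\_system\_update}$ satisfies assumptions (a)–(c) listed in the context (collocated discretization, conservation of linear invariants, preservation of admissibility). Let $\{\rho_h^n,\mathbf m_h^n,E_h^n\}$ have admissible nodal states, $\mathbf U_i^n=[\rho_i^n,\mathbf m_i^n,E_i^n]^{\top}\in\mathcal A$ for all $i\in\mathcal V$, let $\mathbf H_h^n\in\mathbb H_h$, and let $\{\rho_h^{n+1},\mathbf m_h^{n+1},E_h^{n+1},\mathbf H_h^{n+1}\}$ be the output of the procedure $\texttt{mhd\_update}$ described in the context. Then 1. the total energy is preserved: $$\sum_{i\in\mathcal V}m_iE_i^{n+1}+\tfrac\mu2\|\mathbf H_h^{n+1}\|_{L^2(\Omega)}^2=\sum_{i\in\mathcal V}m_iE_i^{n}+\tfrac\mu2\|\mathbf H_h^{n}\|_{L^2(\Omega)}^2;$$ 2. pointwise admissibility holds: $\mathbf U_i^{n+1}=[\rho_i^{n+1},\mathbf m_i^{n+1},E_i^{n+1}]^{\top}\in\mathcal A$ for all $i\in\mathcal V$; 3. the weak divergence is preserved: $(\mathbf H_h^{n+1},\nabla\omega_h)=(\mathbf H_h^n,\nabla\omega_h)$ for all $\omega_h\in\mathbb P_h$, where $(\cdot,\cdot)$ is the $L^2(\Omega)$ inner product; 4. if in addition $\texttt{euler\_system\_update}$ satisfies the global entropy inequality (d) of the context, then $$\sum_{i\in\mathcal V}m_i\,\eta(\mathbf U_i^{n+1})\le\sum_{i\in\mathcal V}m_i\,\eta(\mathbf U_i^n).$$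
   Context: Setting: $\Omega\subset\mathbb R^2$ is a periodic domain with a conforming simplicial mesh $\mathcal T_h$; for $K\in\mathcal T_h$, $T_K:\widehat K\to K$ is the map from the reference simplex. All function spaces are understood with periodicity. $\mu>0$ is a constant. Finite element spaces: $\mathbb V_h=\{v_h\in\mathcal C^0(\Omega): v_h\circ T_K\in\mathbb P^1(\widehat K)\ \forall K\in\mathcal T_h\}$ with nodal basis $\{\phi_i\}_{i\in\mathcal V}$, $\sum_i\phi_i=1$, and $m_i=\int_\Omega\phi_i\,dx$. $\mathbb H_h=\{\mathbf Z_h\in H(\mathrm{curl},\Omega): [\nabla_{\hat{\mathbf x}}T_K]^{\top}\,\mathbf Z_h\circ T_K\in[\mathbb P^1(\widehat K)]^2\ \forall K\in\mathcal T_h\}$ (curl-conforming $\mathrm{BDM}_1$ space). $\mathbb P_h=\{\omega_h\in\mathcal C^0(\Omega):\omega_h\circ T_K\in\mathbb P_2(\widehat K)\ \forall K\in\mathcal T_h\}$. For $\mathbf w,\mathbf v\in[\mathbb V_h]^2$ and $\rho_h\in\mathbb V_h$ with nodal values $\mathbf w_i,\mathbf v_i,\rho_i$, the lumped product is $\langle\rho_h\mathbf w,\mathbf v\rangle=\sum_{i\in\mathcal V}m_i\rho_i\,\mathbf w_i\cdot\mathbf v_i$. In two dimensions vectors are embedded in $\mathbb R^3$ with zero third component, so $\mathrm{curl}\,\mathbf H=(0,0,\partial_1H_2-\partial_2H_1)^{\top}$ and $\mathbf H\times\mathrm{curl}\,\mathbf Z$ is again a planar vector. Admissible set and entropy: $\mathcal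 A=\{[\rho,\mathbf m,E]^{\top}\in\mathbb R^{4}:\rho>0,\ E-\tfrac12|\mathbf m|^2/\rho>0\}$. $\eta(\mathbf U)=-\rho\,s(\mathbf U)$ is the mathematical entropy, where the specific entropy $s(\mathbf U)=s(\rho,e)$ is a function of $\rho$ and of the specific internal energy $e=\rho^{-1}(E-\tfrac{1}{2\rho}|\mathbf m|^2)$. Assumptions on $\texttt{euler\_system\_update}$. It maps $\{\rho_h^n,\mathbf m_h^n,E_h^n\}$ to $\{\rho_h^{n+1},\mathbf m_h^{n+1},E_h^{n+1}\}$; it either returns the time-step size $\tau_n>0$ it used, or is given a prescribed $\tau_n$ as an additional input. In both usages: (a) collocated: $\rho_h=\sum_i\rho_i\phi_i$, $\mathbf m_h=\sum_i\mathbf m_i\phi_i$, $E_h=\sum_iE_i\phi_i$ with $\rho_i,E_i\in\mathbb R$, $\mathbf m_i\in\mathbb R^2$; (b) with periodic boundary conditions, $\sum_im_i\rho_i$, $\sum_im_i\mathbf m_i$ and $\sum_im_iE_i$ are the same for input and output; (c) if all input nodal states are in $\mathcal A$, then all output nodal states are in $\mathcal A$. Optional assumption: (d) with periodic boundary conditions, $\sum_im_i\eta(\mathbf U_i^{\rm out})\le\sum_im_i\eta(\mathbf U_i^{\rm in})$. Procedure $\texttt{source\_update}(\{\rho_h^n,\mathbf m_h^n,E_h^n,\mathbf H_h^n,\tau\})$: set $\mathbf u_i^n=\mathbf m_i^n/\rho_i^n$, $\mathbf u_h^n=\sum_i\mathbf u_i^n\phi_i$; let $(\mathbf u_h^{n+1},\mathbf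 H_h^{n+1})\in[\mathbb V_h]^2\times\mathbb H_h$ be a solution of $$\langle\rho_h^n(\mathbf u_h^{n+1}-\mathbf u_h^n),\mathbf v_h\rangle=-\tau\mu\int_\Omega(\mathbf H_h^{n+1/2}\times\mathrm{curl}\,\mathbf H_h^{n+1/2})\cdot\mathbf v_h\,dx,$$ $$\int_\Omega(\mathbf H_h^{n+1}-\mathbf H_h^n)\cdot\mathbf Z_h\,dx=\tau\int_\Omega(\mathbf H_h^{n+1/2}\times\mathrm{curl}\,\mathbf Z_h)\cdot\mathbf u_h^{n+1/2}\,dx$$ for all $\mathbf v_h\in[\mathbb V_h]^2$, $\mathbf Z_h\in\mathbb H_h$, where $\mathbf u_h^{n+1/2}=\tfrac12(\mathbf u_h^n+\mathbf u_h^{n+1})$ and $\mathbf H_h^{n+1/2}=\tfrac12(\mathbf H_h^n+\mathbf H_h^{n+1})$; then set $\mathbf m_i^{n+1}=\rho_i^n\mathbf u_i^{n+1}$, $\rho_i^{n+1}=\rho_i^n$ and $E_i^{n+1}=E_i^n-\tfrac1{2\rho_i^n}|\mathbf m_i^n|^2+\tfrac1{2\rho_i^{n+1}}|\mathbf m_i^{n+1}|^2$; return $\{\rho_h^{n+1},\mathbf m_h^{n+1},E_h^{n+1},\mathbf H_h^{n+1}\}$. Procedure $\texttt{mhd\_update}(\{\rho_h^n,\mathbf m_h^n,E_h^n,\mathbf H_h^n\})$ (Strang splitting): (i) $\{\rho_h^1,\mathbf m_h^1,E_h^1,\tau_n\}:=\texttt{euler\_system\_update}(\{\rho_h^n,\mathbf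 m_h^n,E_h^n\})$ and $\mathbf H_h^1:=\mathbf H_h^n$; (ii) $\{\rho_h^2,\mathbf m_h^2,E_h^2,\mathbf H_h^2\}:=\texttt{source\_update}(\{\rho_h^1,\mathbf m_h^1,E_h^1,\mathbf H_h^1,2\tau_n\})$; (iii) $\{\rho_h^{n+1},\mathbf m_h^{n+1},E_h^{n+1}\}:=\texttt{euler\_system\_update}(\{\rho_h^2,\mathbf m_h^2,E_h^2,\tau_n\})$ and $\mathbf H_h^{n+1}:=\mathbf H_h^2$; return $\{\rho_h^{n+1},\mathbf m_h^{n+1},E_h^{n+1},\mathbf H_h^{n+1}\}$. *)

(* Defs.v *)
From HB Require Import structures.
From mathcomp Require Import all_boot all_order all_algebra.
From mathcomp Require Import all_classical all_reals all_analysis.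
Set Implicit Arguments.
Unset Strict Implicit.
Unset Printing Implicit Defensive.
Import Order.TTheory GRing.Theory Num.Theory numFieldNormedType.Exports.
Local Open Scope classical_set_scope.
Local Open Scope ring_scope.

(* Functions on the periodic domain are represented by their lattice-periodic
   extensions to the plane R * R. Fields that are only defined almost everywhere
   (elements of L^2, curls, gradients) are represented by functions. *)

Definition leb2 (R : realType) :
    {measure set (measurableTypeR R * measurableTypeR R) -> \bar R} :=
  (@lebesgue_measure R \x @lebesgue_measure R)%E.

Section PlaneCalculus.
Context {R : realType}.
Implicit Types (f c phi : R * R -> R) (F G Z : R * R -> R * R) (x y : R * R).

Definition integral2 (D : set (R * R)) f : R := \int[leb2 R]_(x in D) f x.

Definition dot x y : R := x.1 * y.1 + x.2 * y.2.

Definition pd1 f x : R := derive1 (fun t => f (t, x.2)) x.1.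
Definition pd2 f x : R := derive1 (fun t => f (x.1, t)) x.2.

(* For a continuous piecewise polynomial f this is the a.e. gradient: off the
   mesh skeleton f is classically differentiable; the values taken on the
   skeleton, a null set, are irrelevant. *)
Definition grad f x : R * R := (pd1 f x, pd2 f x).

Fixpoint Ck (k : nat) f : Prop :=
  continuous f /\
  if k is k'.+1 then
    [/\ forall x, derivable (fun t => f (t, x.2)) x.1 1,
        forall x, derivable (fun t => f (x.1, t)) x.2 1,
        Ck k' (pd1 f) & Ck k' (pd2 f)]
  else True.

Definition square (r : R) : set (R * R) :=
  [set x | `|x.1| <= r /\ `|x.2| <= r].

(* C_c^oo(R^2) *)
Definition test_fun phi : Prop :=
  (forall k, Ck k phi) /\ (exists r, forall x, ~ square r x -> phi x = 0).

(* For a periodic f, local square integrability is membership in L^2(Omega). *)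
Definition L2loc f : Prop :=
  measurable_fun (setT : set (measurableTypeR R * measurableTypeR R)) f /\
  forall r, (\int[leb2 R]_(x in square r) ((f x) ^+ 2)%:E < +oo)%E.

(* [weak_curl Z c]: c is a version of the distributional scalar curl
   d_1 Z_2 - d_2 Z_1, and it is square integrable. Versions agree a.e. *)
Definition weak_curl Z c : Prop :=
  L2loc c /\
  forall phi, test_fun phi ->
    integral2 setT (fun x => c x * phi x) =
    integral2 setT (fun x => (Z x).1 * pd2 phi x - (Z x).2 * pd1 phi x).

(* The planar part of (h_1, h_2, 0) x (0, 0, c). *)
Definition cross_curl (h : R * R) (c : R) : R * R := (h.2 * c, - (h.1 * c)).

(* f coincides on D with a polynomial of total degree at most k. *)
Definition poly_on (k : nat) (D : set (R * R)) f : Prop :=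
  exists a : nat -> nat -> R, forall x, D x ->
    f x = \sum_(i < k.+1) \sum_(j < k.+1 | (i + j <= k)%N)
            a i j * x.1 ^+ i * x.2 ^+ j.

Definition ref_simplex : set (R * R) :=
  [set x | [/\ 0 <= x.1, 0 <= x.2 & x.1 + x.2 <= 1]].

Definition ref_simplex_int : set (R * R) :=
  [set x | [/\ 0 < x.1, 0 < x.2 & x.1 + x.2 < 1]].

Definition affine_map (v : 'I_3 -> R * R) x : R * R :=
  v 0 + x.1 *: (v 1 - v 0) + x.2 *: (v 2 - v 0).

Definition hull (v : 'I_3 -> R * R) (I : {set 'I_3}) : set (R * R) :=
  [set x | exists w : 'I_3 -> R,
     [/\ forall i, 0 <= w i, forall i, i \notin I -> w i = 0,
         \sum_i w i = 1 & x = \sum_i w i *: v i]].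

Definition det2 x y : R := x.1 * y.2 - x.2 * y.1.

Definition lattice (a b : R * R) : set (R * R) :=
  [set l | exists m n : int, l = a *~ m + b *~ n].

End PlaneCalculus.

(* A conforming triangulation of the torus R^2 / (Z a + Z b): finitely many
   triangles whose lattice translates form a conforming triangulation of the
   plane. [node] picks one representative of each lattice class of vertices. *)
Record periodic_mesh (R : realType) := PeriodicMesh {
  per1 : R * R;
  per2 : R * R;
  elt : finType;
  vtx : finType;
  corner : elt -> 'I_3 -> R * R;
  node : vtx -> R * R;
  periods_free : det2 per1 per2 != 0;
  elt_nondegenerate : forall K,
    det2 (corner K 1 - corner K 0) (corner K 2 - corner K 0) != 0;
  elts_cover : forall x, exists K l,
    lattice per1 per2 l /\ (affine_map (corner K) @` ref_simplex) (x - l);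
  (* two distinct cells meet in a common proper face, possibly empty *)
  elts_conforming : forall K K' l, lattice per1 per2 l ->
    ~ (K = K' /\ l = 0) ->
    let cap := [set x | (affine_map (corner K) @` ref_simplex) (x - l)]
               `&` affine_map (corner K') @` ref_simplex in
    exists I J : {set 'I_3},
      [/\ I != [set: 'I_3]%SET, J != [set: 'I_3]%SET,
          cap = [set x | hull (corner K) I (x - l)]
        & cap = hull (corner K') J];
  corner_node : forall K k, exists i, lattice per1 per2 (corner K k - node i);
  node_corner : forall i, exists K k, lattice per1 per2 (corner K k - node i);
  node_inj : forall i j, lattice per1 per2 (node i - node j) -> i = j
}.

Section FiniteElements.
Context {R : realType} (M : periodic_mesh R).

Definition elt_map (K : elt M) : R * R -> R * R := affine_map (corner K).

Definition Omega : set (R * R) :=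
  [set x | exists K : elt M, (elt_map K @` ref_simplex) x].

Definition periodic (V : Type) (f : R * R -> V) : Prop :=
  forall x l, lattice (per1 M) (per2 M) l -> f (x + l) = f x.

(* Continuous periodic functions that are mapped P^k on each element. *)
Definition lagrange (k : nat) (f : R * R -> R) : Prop :=
  [/\ continuous f, periodic f &
      forall K : elt M, poly_on k ref_simplex (f \o elt_map K)].

Definition Vh : set (R * R -> R) := lagrange 1.

Definition Vh2 : set (R * R -> R * R) :=
  [set v | Vh (fun x => (v x).1) /\ Vh (fun x => (v x).2)].

Definition Ph : set (R * R -> R) := lagrange 2.

Definition Hcurl : set (R * R -> R * R) :=
  [set Z | [/\ periodic Z,
               L2loc (fun x => (Z x).1), L2loc (fun x => (Z x).2) &
               exists c, weak_curl Z c]].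

(* [grad T_K]^T Z o T_K, the columns of grad T_K being the edge vectors. *)
Definition pullback (K : elt M) (Z : R * R -> R * R) (x : R * R) : R * R :=
  (dot (corner K 1 - corner K 0) (Z (elt_map K x)),
   dot (corner K 2 - corner K 0) (Z (elt_map K x))).

(* Only interiors of elements are constrained: the normal component of Z may
   jump across edges. *)
Definition Hh : set (R * R -> R * R) :=
  [set Z | Hcurl Z /\ forall K : elt M,
     poly_on 1 ref_simplex_int (fun x => (pullback K Z x).1) /\
     poly_on 1 ref_simplex_int (fun x => (pullback K Z x).2)].

Definition L2inner (F G : R * R -> R * R) : R :=
  integral2 Omega (fun x => dot (F x) (G x)).

Definition nodal_basis (phi : vtx M -> R * R -> R) : Prop :=
  (forall i, Vh (phi i)) /\ (forall i j, phi i (node j) = (i == j)%:R).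

End FiniteElements.

(* Conserved variables [rho, m, E]. *)
Record state (R : realType) := State {
  density : R;
  momentum : R * R;
  energy : R
}.

Section Scheme.
Context {R : realType} (M : periodic_mesh R) (phi : vtx M -> R * R -> R).
Implicit Types (U V : vtx M -> state R) (H Z : R * R -> R * R) (tau : R).

Definition internal_energy (u : state R) : R :=
  energy u - dot (momentum u) (momentum u) / (2 * density u).

Definition admissible (u : state R) : Prop :=
  0 < density u /\ 0 < internal_energy u.

(* The entropy -rho s(rho, e), with e the specific internal energy. *)
Definition entropy (s : R -> R -> R) (u : state R) : R :=
  - (density u * s (density u) ((density u)^-1 * internal_energy u)).

Definition mass (i : vtx M) : R := integral2 (Omega M) (phi i).

Definition interp (a : vtx M -> R) (x : R * R) : R := \sum_i a i * phi i x.

Definition interp2 (a : vtx M -> R * R) (x : R * R) : R * R :=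
  \sum_i phi i x *: a i.

Definition lumped (rho : R * R -> R) (w v : R * R -> R * R) : R :=
  \sum_i mass i * rho (node i) * dot (w (node i)) (v (node i)).

(* [None] means that the update is not defined for the given arguments. *)
Record euler_update := EulerUpdate {
  euler_free : (vtx M -> state R) -> option ((vtx M -> state R) * R);
  euler_given : (vtx M -> state R) -> R -> option (vtx M -> state R);
  euler_free_gt0 : forall U V tau, euler_free U = Some (V, tau) -> 0 < tau
}.

Definition euler_run (eu : euler_update) U V : Prop :=
  (exists tau, euler_free eu U = Some (V, tau)) \/
  (exists tau, 0 < tau /\ euler_given eu U tau = Some V).

Definition euler_conservative (eu : euler_update) : Prop :=
  forall U V, euler_run eu U V ->
  [/\ \sum_i mass i * density (V i) = \sum_i mass i * density (U i),
      \sum_i mass i *: momentum (V i) = \sum_i mass i *: momentum (U i)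
    & \sum_i mass i * energy (V i) = \sum_i mass i * energy (U i)].

Definition euler_admissible (eu : euler_update) : Prop :=
  forall U V, euler_run eu U V ->
  (forall i, admissible (U i)) -> forall i, admissible (V i).

Definition euler_entropy (s : R -> R -> R) (eu : euler_update) : Prop :=
  forall U V, euler_run eu U V ->
  \sum_i mass i * entropy s (V i) <= \sum_i mass i * entropy s (U i).

(* [source_update mu U H tau U' H']: (U', H') is obtained from (U, H) through
   some solution (u', H') of the nonlinear system. The curls in the system are
   given through arbitrary versions of the weak curl. *)
Definition source_update (mu : R) U H tau U' H' : Prop :=
  let rho := interp (fun i => density (U i)) in
  let u := interp2 (fun i => (density (U i))^-1 *: momentum (U i)) in
  exists u' : R * R -> R * R,
  let umid := fun x => 2^-1 *: (u x + u' x) in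
  let Hmid := fun x => 2^-1 *: (H x + H' x) in
  [/\ Vh2 M u', Hh M H',
      forall v c, Vh2 M v -> weak_curl Hmid c ->
        lumped rho (fun x => u' x - u x) v =
        - (tau * mu) * L2inner M (fun x => cross_curl (Hmid x) (c x)) v,
      forall Z c, Hh M Z -> weak_curl Z c ->
        L2inner M (fun x => H' x - H x) Z =
        tau * L2inner M (fun x => cross_curl (Hmid x) (c x)) umid
    & forall i, [/\ density (U' i) = density (U i),
        momentum (U' i) = density (U i) *: u' (node i)
      & energy (U' i) = energy (U i)
          - dot (momentum (U i)) (momentum (U i)) / (2 * density (U i))
          + dot (momentum (U' i)) (momentum (U' i)) / (2 * density (U' i))]].

Definition mhd_update (eu : euler_update) (mu : R) U H U' H' : Prop :=
  exists U1 U2 tau,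
  [/\ euler_free eu U = Some (U1, tau),
      source_update mu U1 H (2 * tau) U2 H'
    & euler_given eu U2 tau = Some U'].

End Scheme.

(* Main.v *)
(* The Euler steps and the density and internal energy in the source step are
   handled by the assumptions directly. The energy balance of the source step
   follows by testing the momentum equation with the midpoint velocity and the
   induction equation with the midpoint field: the two right-hand sides cancel.

   For the weak divergence one tests the induction equation with Z = grad omega,
   which requires that grad omega belongs to H_h and has vanishing weak curl.
   A continuous periodic piecewise quadratic omega is globally Lipschitz and
   differentiable off the mesh skeleton, a countable union of segments. Hence
   its partial derivatives are bounded, and the curl is computed as the limit of
   difference quotients by dominated convergence; the partial derivatives of
   a continuous function are Borel measurable whatever happens on the skeleton. *)

Require Import Defs.
From HB Require Import structures.
From mathcomp Require Import all_boot all_order all_algebra.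
From mathcomp Require Import all_classical all_reals all_analysis.
From mathcomp Require Import measurable_realfun zify ring lra.
Import Order.TTheory GRing.Theory Num.Theory numFieldNormedType.Exports.
Local Open Scope classical_set_scope.
Local Open Scope ring_scope.

Set Implicit Arguments.
Unset Strict Implicit.

(** * Borel measurability in the plane *)

Section Borel.
Context {R : realType}.
Local Notation R2 := (measurableTypeR R * measurableTypeR R)%type.

(** Measurability here refers to the product sigma-algebra, so an open set is exhausted by countably
    many boxes with rational centres and radii [1/(n+1)]. *)
Lemma open_measurable2 (U : set (R * R)) : open U -> measurable (U : set R2).
Proof.
move=> oU.
pose B (p q : rat) (n : nat) : set (R * R) :=
  ball (ratr p : R) n.+1%:R^-1 `*` ball (ratr q : R) n.+1%:R^-1.
(* With the inclusion put inside the set, [S p q n] is either the whole box or empty, and the union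
   can run over all indices. *)
pose S p q n := [set x | B p q n `<=` U /\ B p q n x].
have -> : U = \bigcup_p \bigcup_q \bigcup_n S p q n.
  apply/seteqP; split=> [x Ux|x [p _ [q _ [n _ [+ Bx]]]]]; last exact.
  have /nbhs_ballP[e /= e0 He] := open_nbhs_nbhs (conj oU Ux).
  have [n Hn] : exists n : nat, n.+1%:R^-1 < e / 2 :> R.
    have e2 : 0 < (e / 2)^-1 by rewrite invr_gt0 divr_gt0.
    exists (Num.truncn (e / 2)^-1); rewrite invf_plt ?posrE ?divr_gt0 //.
    exact: truncnS_gt.
  pose r : R := n.+1%:R^-1; have r0 : 0 < r by rewrite invr_gt0.
  have [p Hp] := @dense_rat R (ball x.1 r) (ex_intro _ x.1 (ballxx x.1 r0)) (ball_open _ _).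
  have [q Hq] := @dense_rat R (ball x.2 r) (ex_intro _ x.2 (ballxx x.2 r0)) (ball_open _ _).
  move: Hp Hq => [Hp [p' _ p'E]] [Hq [q' _ q'E]].
  exists p' => //; exists q' => //; exists n => //; rewrite -p'E -q'E in Hp Hq.
  split; last by split; exact: ball_sym.
  move=> y [/= y1 y2]; apply: He; apply: (@le_ball _ _ _ (r + r)).
    by rewrite (splitr e) lerD // ltW.
  split; first exact: (ball_triangle Hp y1).
  exact: (ball_triangle Hq y2).
apply: bigcupT_measurable_rat => p; apply: bigcupT_measurable_rat => q.
apply: bigcupT_measurable => n.
have [BU|nBU] := pselect (B p q n `<=` U).
  rewrite (_ : S p q n = B p q n); last first.
    by apply/seteqP; split=> [x []|x Bx].
  by apply: measurableX; apply: open_measurable; exact: ball_open.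
rewrite (_ : S p q n = set0) //.
by apply/seteqP; split=> [x []|].
Qed.

Lemma closed_measurable2 (C : set (R * R)) : closed C -> measurable (C : set R2).
Proof.
by move/closed_openC/open_measurable2/measurableC; rewrite setCK.
Qed.

Lemma continuous_measurable2 (f : R * R -> R) :
  continuous f -> measurable_fun (setT : set R2) f.
Proof.
move=> /continuousP cf; apply: (measurability _ (RGenOpens.measurableE R)).
move=> _ [_ [a [b ->] <-]]; rewrite setTI; apply: open_measurable2.
exact/cf/interval_open.
Qed.

Let quot (f : R * R -> R) v h x : R := h^-1 *: (f (h *: v + x) - f x).

Let quot_continuous f v h : continuous f -> continuous (quot f v h).
Proof.
move=> cf x; apply: cvgZr; apply: cvgB; last exact: cf.
have := @continuous_comp _ _ _ (fun y : R * R => h *: v + y) f x; apply.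
  by apply: cvgD; [exact: cvg_cst|exact: cvg_id].
exact: cf.
Qed.

(* A function is differentiable at x exactly when its difference quotients
   are Cauchy at x; for a continuous function each Cauchy condition is closed. *)
Lemma measurable_derive (f : R * R -> R) v :
  continuous f -> measurable_fun (setT : set R2) ('D_v f).
Proof.
move=> cf.
(* The Cauchy condition with tolerance [1/(k+1)] for all steps shorter than [1/(n+1)]. *)
pose E (k n : nat) : set (R * R) := [set x | forall h h',
  [/\ h != 0, h' != 0, `|h| < n.+1%:R^-1 & `|h'| < n.+1%:R^-1] ->
  `|quot f v h x - quot f v h' x| <= k.+1%:R^-1].
pose D := \bigcap_k \bigcup_n E k n.
have mD : measurable (D : set R2).
  apply: bigcapT_measurable => k; apply: bigcupT_measurable => n.
  apply: closed_measurable2.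
  rewrite (_ : E k n = \bigcap_(p in [set p : R * R |
     [/\ p.1 != 0, p.2 != 0, `|p.1| < n.+1%:R^-1 & `|p.2| < n.+1%:R^-1]])
     (fun x => `|quot f v p.1 x - quot f v p.2 x|) @^-1` [set y | y <= k.+1%:R^-1]); last first.
    apply/seteqP; split => [x Ex p /= Hp|x Ex h h' Hh]; first exact: Ex.
    exact: (Ex (h, h')).
  apply: closed_bigI => p _; apply: preimage_closed; last exact: closed_le.
  move=> x _; apply: cvg_norm; apply: cvgB; exact: quot_continuous.
have quotE x : 'D_v f x = lim ((fun h => quot f v h x) @ 0^').
  by [].
have DP x : D x -> cvg ((fun h => quot f v h x) @ 0^').
  move=> Dx; apply/cauchy_cvgP; apply: cauchy_exP => e e0.
  have [k Hk] : exists k : nat, k.+1%:R^-1 < e :> R.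
    exists (Num.truncn e^-1); rewrite invf_plt ?posrE //.
    exact: truncnS_gt.
  have [n _ Hn] := Dx k I.
  (* The step [1/(n+2)] is strictly below [1/(n+1)], so its quotient can serve as the centre of the
     Cauchy ball. *)
  exists (quot f v (n.+2%:R^-1) x).
  have n2 : (n.+2%:R^-1 : R) < n.+1%:R^-1 by rewrite ltf_pV2 ?posrE // ltr_nat.
  exists (n.+1%:R^-1); rewrite /= ?invr_gt0 // => h /=.
  rewrite sub0r normrN => hn h0; rewrite /ball /=.
  apply: le_lt_trans Hk; apply: Hn; split => //.
  by rewrite ger0_norm // invr_ge0.
have nDP x : cvg ((fun h => quot f v h x) @ 0^') -> D x.
  move=> /cvg_ex[/= l /cvgrPdist_lt cl] k _.
  have k0 : (0 : R) < k.+1%:R^-1 by rewrite invr_gt0.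
  have [e /= e0 He] := cl _ (divr_gt0 k0 (ltr0n _ 2)).
  have [n Hn] : exists n : nat, n.+1%:R^-1 < e :> R.
    exists (Num.truncn e^-1); rewrite invf_plt ?posrE //.
    exact: truncnS_gt.
  exists n => // h h' [h0 h'0 hn h'n].
  rewrite [leRHS]splitr.
  have B g : g != 0 -> `|g| < n.+1%:R^-1 -> `|l - quot f v g x| < k.+1%:R^-1 / 2.
    move=> g0 gn; apply: (He g) => //=.
    by rewrite sub0r normrN (lt_trans gn).
  apply: ltW; apply: (@le_lt_trans _ _ (`|l - quot f v h x| + `|l - quot f v h' x|)).
    rewrite (_ : quot f v h x - _ = (l - quot f v h' x) - (l - quot f v h x)).
      by rewrite [leRHS]addrC ler_normB.
    by ring.
  by rewrite ltrD // B.
(* Where the quotients diverge, [lim] takes the default value 0; multiplying by the indicator of [D]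
   makes the sequence converge to exactly this value. *)
apply: (@measurable_fun_cvg _ _ _ _
  (fun n x => quot f v n.+1%:R^-1 x * \1_D x)).
  move=> n; apply: measurable_funM; last exact: measurable_indic.
  by apply: continuous_measurable2; exact: quot_continuous.
move=> x _; rewrite quotE.
have [Dx|nDx] := pselect (D x).
  rewrite indicE mem_set //=.
  under eq_fun do rewrite mulr1.
  have /cvg_ex[l Hl] := DP _ Dx; rewrite (cvg_lim _ Hl) //.
  move/cvgr_dnbhsP : Hl; apply; split; last exact: cvg_harmonic.
  by move=> n; rewrite invr_neq0.
rewrite indicE memNset //=.
under eq_fun do rewrite mulr0.
rewrite dvgP; first exact: cvg_cst.
by move=> /nDP.
Qed.

End Borel.

(** * Lebesgue measure in the plane: translations, null lines, local square integrability *)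

Section PlaneMeasure.
Context {R : realType}.
Local Notation R2 := (measurableTypeR R * measurableTypeR R)%type.
Implicit Types (f g c : R * R -> R) (v : R * R).

Lemma closed_square r : closed (square r : set (R * R)).
Proof.
rewrite (_ : square r = [set x | `|x.1| <= r] `&` [set x | `|x.2| <= r]); last first.
  by apply/seteqP; split => x [].
apply: closedI.
  apply: (@preimage_closed _ _ (fun x : R * R => `|x.1|) [set y | y <= r]); last exact: closed_le.
  by move=> x _; apply: cvg_norm; exact: cvg_fst.
apply: (@preimage_closed _ _ (fun x : R * R => `|x.2|) [set y | y <= r]); last exact: closed_le.
by move=> x _; apply: cvg_norm; exact: cvg_snd.
Qed.

Lemma squareE r : square r = `[- r, r]%classic `*` `[- r, r]%classic :> set (R * R).
Proof.
by apply/seteqP; split=> [x []|x []] /=; rewrite !in_itv /= -!ler_norml.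
Qed.

Lemma measurable_square r : measurable (square r : set R2).
Proof. by apply: closed_measurable2; exact: closed_square. Qed.

Lemma leb2_square r : (leb2 R (square r) < +oo)%E.
Proof.
rewrite squareE /leb2 /= product_measure1E //.
rewrite lte_mul_pinfty //.
  rewrite ge0_fin_numE //; move: (lebesgue_measure_itv `[-r, r]); rewrite /= => ->.
  by case: ifPn => _; rewrite ltry.
by move: (lebesgue_measure_itv `[-r, r]) => /= ->; case: ifPn => _; rewrite ltry.
Qed.

(** Lebesgue measure is determined by its values on half-open intervals, and its image under a
    translation gives them the same length. *)
Lemma lebesgue_shift (a : R) (A : set (measurableTypeR R)) : measurable A ->
  lebesgue_measure [set t | A (t + a)] = lebesgue_measure A.
Proof.
move=> mA.
pose sh (t : measurableTypeR R) : measurableTypeR R := t + a.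
have msh : measurable_fun setT sh by apply: measurable_funD.
pose m' : {measure set (measurableTypeR R) -> \bar R} :=
  measure_function_pushforward__canonical__measure_function_Measure lebesgue_measure msh.
apply/esym; apply: (@lebesgue_measure_unique R m') => // X [[p q] _ <-] /=.
rewrite /m' /= /pushforward (_ : sh @^-1` _ = `]p - a, q - a]%classic).
  move: (lebesgue_measure_itv `]p, q]) (lebesgue_measure_itv `]p - a, q - a]) => /= -> ->.
  by rewrite !lte_fin ltrD2r -!EFinB; case: ifPn => // _; congr EFin; ring.
by apply/seteqP; split => t /=; rewrite !in_itv /= /sh ltrBlDr lerBrDr.
Qed.

Let shift2_measurable v : measurable_fun (setT : set R2) (fun x : R2 => x + v : R2).
Proof.
apply: measurable_fun_pair; apply: measurable_funD => //=.
Qed.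

(** A product measure is determined by its values on rectangles, which reduces the claim to one
    translation in each variable. *)
Lemma leb2_shift v (A : set R2) : measurable A ->
  leb2 R [set x | A (x + v)] = leb2 R A.
Proof.
move=> mA.
pose m' : {measure set R2 -> \bar R} :=
  measure_function_pushforward__canonical__measure_function_Measure (leb2 R) (shift2_measurable v).
apply/esym; apply: (@product_measure_unique _ _ _ _ R _ _ m') => // B C mB mC.
rewrite /m' /= /pushforward -[in RHS](lebesgue_shift v.1 mB) -[in RHS](lebesgue_shift v.2 mC).
rewrite -product_measure1E //.
- by rewrite -[X in measurable X]setTI; apply: measurable_funD => //.
- by rewrite -[X in measurable X]setTI; apply: measurable_funD => //.
Qed.

Let ge0_integral_shift v (f : R2 -> \bar R) : measurable_fun setT f ->
  (forall x, 0 <= f x)%E -> (\int[leb2 R]_x f (x + v)%R = \int[leb2 R]_x f x)%E.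
Proof.
move=> mf f0.
pose m' : {measure set R2 -> \bar R} :=
  measure_function_pushforward__canonical__measure_function_Measure (leb2 R) (shift2_measurable v).
transitivity (\int[m']_x f x)%E.
  by rewrite (ge0_integral_pushforward (shift2_measurable v)).
by apply: eq_measure_integral => A mA _; rewrite -(leb2_shift v mA).
Qed.

(** The positive and negative parts are shifted separately by the nonnegative case. *)
Lemma integral2_shift v f : measurable_fun (setT : set R2) f ->
  integral2 setT (fun x => f (x + v)) = integral2 setT f.
Proof.
move=> /measurable_EFinP mf.
rewrite /integral2 /Rintegral; congr fine.
rewrite integralE [RHS]integralE; congr (_ - _)%E.
  rewrite -[RHS](ge0_integral_shift v) //; last exact: measurable_funepos.
  by apply: eq_integral => x _; rewrite unlock.
rewrite -[RHS](ge0_integral_shift v) //; last exact: measurable_funeneg.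
by apply: eq_integral => x _; rewrite unlock.
Qed.

(** A vertical line is a null rectangle. Any other line meets each vertical section in one point, so
    the iterated integral vanishes. *)
Lemma leb2_line (p : R * R) q : p != 0 ->
  leb2 R [set x | dot p x = q] = 0%E.
Proof.
move=> p0; have [p2|p2] := eqVneq p.2 0.
  have p1 : p.1 != 0 by apply: contra_neq p0 => p1; case: p p1 p2 => ? ? /= -> ->.
  rewrite (_ : [set x | _] = [set q / p.1] `*` setT).
    rewrite /leb2 /= product_measure1E //.
    by move: (lebesgue_measure_set1 (q / p.1)) => /= ->; rewrite mul0e.
  apply/seteqP; split => [[x y]|[x y] []] /=; rewrite /dot /= p2 mul0r addr0.
    by move=> <-; split => //; rewrite mulrAC mulfV // mul1r.
  by move=> -> _; rewrite mulrCA mulfV // mulr1.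
rewrite /leb2 /= /product_measure1 integral0_eq // => x _ /=.
rewrite (_ : xsection _ _ = [set (q - p.1 * x) / p.2]).
  exact: lebesgue_measure_set1.
apply/seteqP; split => y; rewrite /xsection /= inE /dot /=.
  by move=> <-; rewrite addrC addKr mulrAC mulfV // mul1r.
by move=> ->; rewrite mulrCA mulfV // mulr1 addrC subrK.
Qed.

Lemma integrable2_bounded r C f : measurable_fun (setT : set R2) f ->
  (forall x, `|f x| <= C) -> (forall x, ~ square r x -> f x = 0) ->
  (leb2 R).-integrable setT (EFin \o f).
Proof.
move=> mf fC f0; have mS := measurable_square r.
have fE : EFin \o f = (EFin \o f) \_ (square r).
  apply/funext => x; rewrite patchE; case: ifPn => //= /negP xS.
  by rewrite f0 // => ?; apply: xS; exact: mem_set.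
rewrite fE; apply/(integrable_mkcond _ mS).
apply: measurable_bounded_integrable => //.
- exact: leb2_square.
- exact: measurable_funTS.
- by exists C; split; [exact: num_real|move=> M CM x _; exact: le_trans (fC x) (ltW CM)].
Qed.

(** The product is dominated by [f ^+ 2 + g ^+ 2]. *)
Lemma L2loc_integrableM r f g : L2loc f -> L2loc g ->
  (leb2 R).-integrable (square r) (EFin \o (fun x => f x * g x)).
Proof.
move=> [mf fi] [mg gi]; have mS := measurable_square r.
have sqi (h : R * R -> R) : measurable_fun (setT : set R2) h ->
    (\int[leb2 R]_(x in square r) ((h x) ^+ 2)%:E < +oo)%E ->
    (leb2 R).-integrable (square r) (EFin \o (fun x => h x ^+ 2)).
  move=> mh hi; apply/integrableP; split.
    by apply/measurable_EFinP/measurable_funTS; exact: measurable_funX.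
  apply: le_lt_trans hi; rewrite le_eqVlt; apply/orP; left; apply/eqP.
  by apply: eq_integral => x _ /=; rewrite ger0_norm // sqr_ge0.
apply: (le_integrable mS _ _ (integrableD mS (sqi _ mf (fi r)) (sqi _ mg (gi r)))).
  by apply/measurable_EFinP/measurable_funTS; exact: measurable_funM.
move=> x _ /=; rewrite lee_fin normrM [leRHS]ger0_norm ?addr_ge0 ?sqr_ge0 //.
rewrite -(real_normK (num_real (f x))) -(real_normK (num_real (g x))).
have : 0 <= (`|f x| - `|g x|) ^+ 2 by exact: sqr_ge0.
have : 0 <= `|f x| * `|g x| by rewrite mulr_ge0.
by nra.
Qed.

Lemma L2loc_bounded C f : measurable_fun (setT : set R2) f ->
  (forall x, `|f x| <= C) -> L2loc f.
Proof.
move=> mf fC; split=> // q.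
have : (leb2 R).-integrable (square q) (EFin \o (fun x => f x ^+ 2)).
  apply: measurable_bounded_integrable.
  - exact: measurable_square.
  - exact: leb2_square.
  - by apply: measurable_funTS; exact: measurable_funX.
  - exists (C ^+ 2); split; first exact: num_real.
    move=> M CM x _; apply: le_trans (ltW CM); rewrite normrX lerXn2r ?nnegrE //.
    exact: le_trans (fC x).
by move=> /integrable_lty; apply; exact: measurable_square.
Qed.

Lemma L2loc_integrable_test r C c f : L2loc c -> measurable_fun (setT : set R2) f ->
  (forall x, `|f x| <= C) -> (forall x, ~ square r x -> f x = 0) ->
  (leb2 R).-integrable setT (EFin \o (fun x => c x * f x)).
Proof.
move=> cL mf fC f0; have mS := measurable_square r.
have fE : EFin \o (fun x => c x * f x) = (EFin \o (fun x => c x * f x)) \_ (square r).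
  apply/funext => x; rewrite patchE; case: ifPn => //= /negP xS.
  by rewrite f0 ?mulr0 // => ?; apply: xS; exact: mem_set.
rewrite fE; apply/(integrable_mkcond _ mS); apply: L2loc_integrableM => //.
exact: L2loc_bounded fC.
Qed.

Lemma L2loc_half_sum f g : L2loc f -> L2loc g -> L2loc (fun x => 2^-1 * (f x + g x)).
Proof.
move=> fL gL; have [mf _] := fL; have [mg _] := gL; split.
  by apply: measurable_funM => //; exact: measurable_funD.
move=> r; have mS := measurable_square r.
have i1 := L2loc_integrableM r fL fL; have i2 := L2loc_integrableM r gL gL.
have : (leb2 R).-integrable (square r) (EFin \o (fun x => (2^-1 * (f x + g x)) ^+ 2)).
  apply: (le_integrable mS _ _ (integrableD mS i1 i2)).
    apply/measurable_EFinP/measurable_funTS/measurable_funX.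
    by apply: measurable_funM => //; exact: measurable_funD.
  move=> x _ /=; rewrite lee_fin ger0_norm ?sqr_ge0 // ger0_norm ?addr_ge0 -?expr2 ?sqr_ge0 //.
  have : 0 <= (f x - g x) ^+ 2 by exact: sqr_ge0.
  have := sqr_ge0 (f x); have := sqr_ge0 (g x).
  by nra.
by move=> /integrable_lty; apply; exact: measurable_square.
Qed.

End PlaneMeasure.

(** * The weak curl of a gradient *)

Section WeakCurl.
Context {R : realType}.
Local Notation R2 := (measurableTypeR R * measurableTypeR R)%type.
Implicit Types (f g c phi : R * R -> R) (x v : R * R).

Let quot1E f x (h : R) :
  h^-1 *: (((fun t => f (t, x.2)) \o shift x.1) (h *: 1) - f (x.1, x.2)) =
  h^-1 *: ((f \o shift x) (h *: (1, 0)) - f x).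
Proof.
by case: x => a b; congr (_ *: (f (_, _) - _)); rewrite /= [_ *: _]mulr0 add0r.
Qed.

Let quot2E f x (h : R) :
  h^-1 *: (((fun t => f (x.1, t)) \o shift x.2) (h *: 1) - f (x.1, x.2)) =
  h^-1 *: ((f \o shift x) (h *: (0, 1)) - f x).
Proof.
by case: x => a b; congr (_ *: (f (_, _) - _)); rewrite /= [_ *: _]mulr0 add0r.
Qed.

(** The one-variable and the planar quotients are the same function of the step, so the limits agree
    even where they exist only as default values. *)
Lemma pd1E f : pd1 f = 'D_(1, 0) f.
Proof.
apply/funext => x; rewrite /pd1 derive1E /derive.
exact: (congr1 (fun F : R -> R => lim (F @ 0^')) (funext (quot1E f x))).
Qed.

Lemma pd2E f : pd2 f = 'D_(0, 1) f.
Proof.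
apply/funext => x; rewrite /pd2 derive1E /derive.
exact: (congr1 (fun F : R -> R => lim (F @ 0^')) (funext (quot2E f x))).
Qed.

Lemma derivable_pd1 f x : derivable (fun t => f (t, x.2)) x.1 1 = derivable f x (1, 0).
Proof.
exact: (congr1 (fun F : R -> R => cvg (F @ 0^')) (funext (quot1E f x))).
Qed.

Lemma derivable_pd2 f x : derivable (fun t => f (x.1, t)) x.2 1 = derivable f x (0, 1).
Proof.
exact: (congr1 (fun F : R -> R => cvg (F @ 0^')) (funext (quot2E f x))).
Qed.

Lemma cvg_quotient f x v (u : nat -> R) : derivable f x v ->
  (forall n, u n != 0) -> u n @[n --> \oo] --> 0 ->
  (u n)^-1 * (f (u n *: v + x) - f x) @[n --> \oo] --> 'D_v f x.
Proof.
move=> /cvg_ex[l fl] u0 cu; rewrite /derive (cvg_lim _ fl) //.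
by move/cvgr_dnbhsP : fl; apply.
Qed.

Lemma bounded_support r g : continuous g -> (forall x, ~ square r x -> g x = 0) ->
  exists C, 0 <= C /\ forall x, `|g x| <= C.
Proof.
move=> cg g0.
have : compact (g @` square r).
  apply: continuous_compact; first exact: continuous_subspaceT.
  by rewrite squareE; apply: compact_setX; exact: segment_compact.
move=> /compact_bounded[M [_ HM]].
exists (Num.max 0 (M + 1)); split; first by rewrite le_max lexx.
move=> x; have [Sx|/g0->] := pselect (square r x); last by rewrite normr0 le_max lexx.
rewrite le_max; apply/orP; right; apply: HM; last by exists x.
by rewrite ltrDl.
Qed.

Lemma lipschitz_derive1 (g : R -> R) (C : R) : (forall t, derivable g t 1) ->
  (forall t, `|derive1 g t| <= C) -> forall s t, `|g t - g s| <= C * `|t - s|.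
Proof.
move=> dg gC s t; wlog st : s t / s <= t.
  move=> H; have [|/ltW] := leP s t; first exact: H.
  by rewrite distrC [`|t - s|]distrC; exact: H.
have dg' (z : R) : z \in `]s, t[ -> is_derive z 1 g (derive1 g z).
  by move=> _; rewrite derive1E; exact: derivableP.
have [|c _ ->] := MVT_segment st dg'.
  by apply: derivable_within_continuous => z _.
by rewrite normrM ler_wpM2r.
Qed.

(** The complement of a closed square is open, so outside the support square the function is locally
    zero and its partial derivatives vanish too. Continuity on the compact square supplies the
    bounds. *)
Lemma test_fun_bounds phi : test_fun phi -> exists r C,
  [/\ continuous phi, continuous (pd1 phi), continuous (pd2 phi),
      forall x, ~ square r x -> [/\ phi x = 0, pd1 phi x = 0 & pd2 phi x = 0] &
      [/\ 0 <= C, forall x, `|phi x| <= C, forall x, `|pd1 phi x| <= C &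
      forall x, `|pd2 phi x| <= C]].
Proof.
move=> [/(_ 1)/=[cp [_ _ [c1 _] [c2 _]]] [r p0]].
have S x : ~ square r x -> [/\ phi x = 0, pd1 phi x = 0 & pd2 phi x = 0].
  move=> nx; have N : \forall y \near x, phi y = cst 0 y.
    apply: filterS (p0) _; apply: open_nbhs_nbhs; split => //.
    exact/closed_openC/closed_square.
  by rewrite pd1E pd2E; split; [exact: p0|rewrite (near_eq_derive _ N) derive_cst..].
have [C0 [C00 HC0]] := bounded_support cp (fun x nx => let: And3 a _ _ := S x nx in a).
have [C1 [C10 HC1]] := bounded_support c1 (fun x nx => let: And3 _ a _ := S x nx in a).
have [C2 [C20 HC2]] := bounded_support c2 (fun x nx => let: And3 _ _ a := S x nx in a).
exists r, (C0 + C1 + C2); split => //; split => [|x|x|x].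
- by rewrite !addr_ge0.
- by apply: (le_trans (HC0 x)); lra.
- by apply: (le_trans (HC1 x)); lra.
- by apply: (le_trans (HC2 x)); lra.
Qed.

Let I g := (leb2 R).-integrable setT (EFin \o g).

Let IB g1 g2 : I g1 -> I g2 -> I (fun x => g1 x - g2 x).
Proof. by move=> i1 i2; have := integrableB measurableT i1 i2; exact. Qed.

Let J f g v w := integral2 setT (fun x => f (v + x) * g (w + x)).

Let continuous_addl g v : continuous g -> continuous (fun x => g (v + x)).
Proof.
move=> cg x; have := @continuous_comp _ _ _ (fun y : R * R => v + y) g x; apply.
  by apply: cvgD; [exact: cvg_cst|exact: cvg_id].
exact: cg.
Qed.

Let I_prod r f phi v w : continuous f -> continuous phi ->
  (forall x, ~ square r x -> phi x = 0) -> I (fun x => f (v + x) * phi (w + x)).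
Proof.
move=> cf cp p0.
have cfp : continuous (fun x => f (v + x) * phi (w + x)).
  by move=> x; apply: continuousM; exact: continuous_addl.
have S x : ~ square (r + `|w.1| + `|w.2|) x -> f (v + x) * phi (w + x) = 0.
  move=> nx; rewrite p0 ?mulr0 // => -[/= w1 w2]; apply: nx; split.
    rewrite (_ : x.1 = (w.1 + x.1) - w.1); last by rewrite addrAC subrr add0r.
    by apply: (le_trans (ler_normB _ _)); have := normr_ge0 w.2; lra.
  rewrite (_ : x.2 = (w.2 + x.2) - w.2); last by rewrite addrAC subrr add0r.
  by apply: (le_trans (ler_normB _ _)); have := normr_ge0 w.1; lra.
have [C [_ HC]] := bounded_support cfp S.
by apply: (integrable2_bounded _ HC S); exact: continuous_measurable2.
Qed.

Let J_shift f phi v w t : continuous f -> continuous phi -> J f phi (v + t) (w + t) = J f phi v w.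
Proof.
move=> cf cp; rewrite /J -[RHS](integral2_shift t).
  by rewrite /integral2; apply: eq_Rintegral => x _; rewrite !(addrC x) !addrA.
apply: continuous_measurable2 => x; apply: continuousM; exact: continuous_addl.
Qed.

Let Q g (u : R) v x := u^-1 * (g (u *: v + x) - g x).

Let int_Q r f phi u v w : continuous f -> continuous phi ->
    (forall x, ~ square r x -> phi x = 0) ->
  let F := fun x => Q f u v x * Q phi u w x in
  I F /\ integral2 setT F = u^-1 ^+ 2 *
    ((J f phi (u *: v) (u *: w) - J f phi (u *: v) 0) -
     (J f phi 0 (u *: w) - J f phi 0 0)).
Proof.
move=> cf cp p0 F.
pose G x := (f (u *: v + x) * phi (u *: w + x) - f (u *: v + x) * phi (0 + x)) -
            (f (0 + x) * phi (u *: w + x) - f (0 + x) * phi (0 + x)).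
have -> : F = fun x => u^-1 ^+ 2 * G x.
  by apply/funext => x; rewrite /F /G /Q !add0r; ring.
have i v' w' : I (fun x => f (v' + x) * phi (w' + x)) by exact: I_prod p0.
have iG : I G by apply: IB; exact: IB.
split; first by have := integrableZl measurableT (u^-1 ^+ 2) iG; exact.
rewrite /integral2 RintegralZl //; congr (_ * _).
rewrite RintegralB //; [|exact: IB|exact: IB].
by rewrite !RintegralB //; exact: i.
Qed.

(** Both sides expand into four values of [J], which depends only on the difference of its two
    shifts. The differences are [u v - u w], [u v], [- u w] and 0 on either side, with the middle
    two exchanged. *)
Let int_Q_eq r f phi u v w : continuous f -> continuous phi ->
    (forall x, ~ square r x -> phi x = 0) ->
  integral2 setT (fun x => Q f u v x * Q phi u w x) =
  integral2 setT (fun x => Q f (- u) w x * Q phi (- u) v x).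
Proof.
move=> cf cp p0; rewrite (int_Q u v w cf cp p0).2 (int_Q (- u) w v cf cp p0).2.
rewrite invrN sqrrN !scaleNr.
rewrite -[J _ _ (- (u *: w)) (- (u *: v))](J_shift _ _ (u *: v + u *: w) cf cp).
rewrite -[J _ _ (- (u *: w)) 0](J_shift _ _ (u *: w) cf cp).
rewrite -[J _ _ 0 (- (u *: v))](J_shift _ _ (u *: v) cf cp).
rewrite !addNr !add0r [u *: v + u *: w]addrC addKr [u *: w + u *: v]addrC addKr.
by congr (_ * _); ring.
Qed.

(* Discrete summation by parts moves one difference quotient off each factor,
   so only first derivatives enter the limit and no Clairaut theorem is needed. *)
Lemma weak_curl_grad f L : continuous f ->
  (forall x h, `|f (h *: (1, 0) + x) - f x| <= L * `|h|) ->
  (forall x h, `|f (h *: (0, 1) + x) - f x| <= L * `|h|) ->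
  (leb2 R).-negligible [set x | ~ (derivable f x (1, 0) /\ derivable f x (0, 1))] ->
  weak_curl (grad f) (fun=> 0).
Proof.
move=> cf L1 L2 fd; split.
  split; first exact: measurable_cst.
  by move=> r; under eq_integral do rewrite expr0n /=; rewrite integral0 ltry.
move=> phi tphi; have [r [C [cp c1 c2 S [C0 pC p1C p2C]]]] := test_fun_bounds tphi.
have [_ [d1 d2 _ _]] := tphi.1 1%N.
have dp1 x : derivable phi x (1, 0) by rewrite -derivable_pd1.
have dp2 x : derivable phi x (0, 1) by rewrite -derivable_pd2.
have p0 x : ~ square r x -> phi x = 0 by case/S.
have Lp1 x h : `|phi (h *: (1, 0) + x) - phi x| <= C * `|h|.
  have := lipschitz_derive1 (fun t => d1 (t, x.2)) (fun t => p1C (t, x.2)) x.1 (h + x.1).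
  rewrite addrK; congr (`|phi _ - phi _| <= _); last by case: x.
  by case: x => a b; congr pair => /=; rewrite ?[_ *: _]mulr1 ?[_ *: _]mulr0 ?add0r.
have Lp2 x h : `|phi (h *: (0, 1) + x) - phi x| <= C * `|h|.
  have := lipschitz_derive1 (fun t => d2 (x.1, t)) (fun t => p2C (x.1, t)) x.2 (h + x.2).
  rewrite addrK; congr (`|phi _ - phi _| <= _); last by case: x.
  by case: x => a b; congr pair => /=; rewrite ?[_ *: _]mulr1 ?[_ *: _]mulr0 ?add0r.
have Qle g K u v x : u != 0 -> (forall x h, `|g (h *: v + x) - g x| <= K * `|h|) ->
    `|Q g u v x| <= K.
  move=> u0 H; rewrite /Q normrM normfV ler_pdivrMl ?normr_gt0 // mulrC.
  exact: H.
(* A step of size at most 1 enlarges the support square by at most 1. *)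
have Qp0 u v x : `|u| <= 1 -> `|v.1| <= 1 -> `|v.2| <= 1 -> ~ square (r + 1) x -> Q phi u v x = 0.
  move=> u1 v1 v2 nx.
  have uv1 : `|u * v.1| <= 1 by rewrite normrM mulr_ile1.
  have uv2 : `|u * v.2| <= 1 by rewrite normrM mulr_ile1.
  rewrite /Q !p0 ?subrr ?mulr0 // => -[/= w1 w2]; apply: nx; split.
  - lra.
  - lra.
  - rewrite (_ : x.1 = (u * v.1 + x.1) - u * v.1); last by rewrite addrAC subrr add0r.
    by apply: (le_trans (ler_normB _ _)); rewrite lerD.
  - rewrite (_ : x.2 = (u * v.2 + x.2) - u * v.2); last by rewrite addrAC subrr add0r.
    by apply: (le_trans (ler_normB _ _)); rewrite lerD.
pose h n : R := n.+1%:R^-1.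
have h0 n : h n != 0 by rewrite invr_neq0.
have h1 n : `|h n| <= 1 by rewrite ger0_norm ?invr_ge0 // invf_le1 // ler1n.
(* The steps are reversed in the second product so that [int_Q_eq] makes the integral of [F n]
   vanish exactly; the sign of the step does not affect the pointwise limit. *)
pose F n x := Q f (h n) (1, 0) x * Q phi (h n) (0, 1) x -
              Q f (- h n) (0, 1) x * Q phi (- h n) (1, 0) x.
have iF n : I (F n).
  by apply: IB; [exact: (int_Q _ _ _ cf cp p0).1|exact: (int_Q _ _ _ cf cp p0).1].
have F0 n : (\int[leb2 R]_x (F n x)%:E = 0)%E.
  have : integral2 setT (F n) = 0.
    rewrite /integral2 RintegralB //.
    - by apply/eqP; rewrite subr_eq0; apply/eqP; exact: (int_Q_eq _ _ _ cf cp p0).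
    - exact: (int_Q _ _ _ cf cp p0).1.
    - exact: (int_Q _ _ _ cf cp p0).1.
  move=> H; have := congr1 EFin H; rewrite /integral2 /Rintegral fineK //.
  exact: integrable_fin_num (iF n).
pose F' x := pd1 f x * pd2 phi x - pd2 f x * pd1 phi x.
have mF' : measurable_fun (setT : set R2) F'.
  apply: measurable_funB; apply: measurable_funM.
  - by rewrite pd1E; exact: measurable_derive.
  - exact: continuous_measurable2.
  - by rewrite pd2E; exact: measurable_derive.
  - exact: continuous_measurable2.
have L0 : 0 <= L by have := L1 0 1; rewrite normr1 mulr1; exact: le_trans.
(* The dominating function: quotients of [f] are bounded by [L], those of [phi] by [C], and [F n] is
   a difference of two such products. *)
pose G x : R := 2 * L * C * \1_(square (r + 1)) x.
have G0 x : 0 <= G x by rewrite /G !mulr_ge0.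
have iG : I G.
  apply: (@integrable2_bounded _ (r + 1) (2 * L * C)).
  - apply: measurable_funM => //; apply: measurable_indic; exact: measurable_square.
  - move=> x; rewrite ger0_norm // /G; apply: ler_piMr; first by rewrite !mulr_ge0.
    by rewrite indicE; case: (x \in _) => /=.
  - by move=> x nx; rewrite /G indicE memNset // mulr0.
have FG x n : `|F n x| <= G x.
  have [Sx|nSx] := pselect (square (r + 1) x).
    rewrite /G indicE mem_set // mulr1 /F; apply: (le_trans (ler_normB _ _)).
    have -> : 2 * L * C = L * C + L * C by ring.
    apply: lerD; rewrite normrM; apply: ler_pM => //; apply: Qle => //; rewrite ?oppr_eq0 //.
  by rewrite /F !Qp0 ?mulr0 ?subrr ?normr0 //= ?normrN ?normr0 ?normr1.
have FF' x : derivable f x (1, 0) /\ derivable f x (0, 1) -> F n x @[n --> \oo] --> F' x.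
  move=> -[df1 df2].
  rewrite /F' pd1E pd2E pd1E pd2E; apply: cvgB; apply: cvgM.
  - by apply: cvg_quotient => //; exact: cvg_harmonic.
  - by apply: cvg_quotient => //; exact: cvg_harmonic.
  - apply: cvg_quotient => //; first by move=> n; rewrite oppr_eq0.
    by rewrite -oppr0; apply: cvgN; exact: cvg_harmonic.
  - apply: cvg_quotient => //; first by move=> n; rewrite oppr_eq0.
    by rewrite -oppr0; apply: cvgN; exact: cvg_harmonic.
have [] := @dominated_convergence _ _ R (leb2 R) setT measurableT
  (fun n x => (F n x)%:E) (EFin \o F') (EFin \o G).
- by move=> n; apply: (measurable_int (leb2 R)); exact: iF.
- exact/measurable_EFinP.
- apply: negligibleS fd => x /= nx; apply: contra_not nx => /FF' H _.
  by apply/fine_cvgP; split; [exact: nearW|exact: H].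
- exact: iG.
- by apply: aeW => x n _; rewrite /= lee_fin.
move=> iF' _; under eq_fun do rewrite F0.
move=> /(cvg_unique _ (cvg_cst _)) E.
rewrite [RHS](_ : _ = 0); last by rewrite /integral2 /Rintegral -E.
by rewrite /integral2; under eq_Rintegral do rewrite mul0r; rewrite Rintegral_cst // mul0r.
Qed.

End WeakCurl.

(** * Gluing Lipschitz bounds along a segment *)

Section LipschitzCover.
Context {R : realType}.

(* Leave a closed set containing the left end point at its last point: what
   remains of the segment is covered by the other sets. *)
Lemma lipschitz_cover (I : finType) (F : I -> set R) (g : R -> R) (L : R) :
  continuous g -> (forall i, closed (F i)) ->
  (forall i s t, F i s -> F i t -> `|g t - g s| <= L * `|t - s|) ->
  forall s t, s <= t -> (forall r, s <= r <= t -> exists i, F i r) ->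
  `|g t - g s| <= L * (t - s).
Proof.
move=> cg cF gL s t st stF.
have {stF} : forall r, s <= r <= t -> exists2 i, i \in [set: I]%SET & F i r.
  by move=> r /stF[i Fi]; exists i => //; rewrite inE.
(* The induction is on the number of closed sets still available for the cover. *)
move: [set: I]%SET => A; have [n] := ubnP #|A|.
elim: n A s st => // n IH A s st An stA.
have [|i iA Fis] := stA s; first by rewrite lexx st.
pose S := F i `&` `[s, t]%classic.
have S0 : S !=set0 by exists s; split; rewrite //= in_itv /= lexx.
have St r : S r -> r <= t by case=> _; rewrite /= in_itv /= => /andP[].
have supS : has_sup S by split => //; exists t => r /St.
pose b := sup S.
have [Fib] : S b.
  have cS : closed S by apply: closedI => //; exact: interval_closed.
  by have := closure_sup S0 supS.2; rewrite -((closure_id S).1 cS).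
rewrite /= in_itv /= => /andP[sb bt].
have sbL : `|g b - g s| <= L * (b - s) by rewrite -[b - s]ger0_norm ?subr_ge0 //; exact: gL Fis Fib.
suff btL : `|g t - g b| <= L * (t - b).
  rewrite -(subrK (g b) (g t)) -addrA (le_trans (ler_normD _ _)) //.
  by apply: le_trans (lerD btL sbL) _; rewrite -mulrDr; lra.
have [->|bt'] := eqVneq b t; first by rewrite !subrr normr0 mulr0.
have {bt' bt} bt : b < t by rewrite lt_neqAle bt'.
(* Beyond the last point [b] of [F i], the set [F i] no longer occurs, so the induction hypothesis
   applies from any later starting point. The case of [b] itself follows by continuity. *)
have rtL r : b < r -> r <= t -> `|g t - g r| <= L * (t - r).
  move=> br rt; apply: (IH (A :\ i)) => //.
    by move: An; rewrite (cardsD1 i A) iA.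
  move=> q /andP[rq qt].
  have bq : b < q by exact: lt_le_trans rq.
  have [|j jA Fjq] := stA q; first by rewrite qt andbT ltW // (le_lt_trans sb).
  exists j => //; rewrite !inE jA andbT; apply: contraTneq bq => ji.
  rewrite -leNgt; apply: (ub_le_sup supS.2); split; first by rewrite -ji.
  by rewrite /= in_itv /= qt andbT ltW // (le_lt_trans sb) // (lt_le_trans br).
pose u r := `|g t - g r| - L * (t - r).
rewrite leNgt; apply/negP => Lb.
have cu : continuous u.
  move=> r; apply: cvgB; first by apply: cvg_norm; apply: cvgB; [exact: cvg_cst|exact: cg].
  by apply: cvgM; [exact: cvg_cst|apply: cvgB; [exact: cvg_cst|exact: cvg_id]].
have ub : 0 < u b by rewrite subr_gt0.
have [e /= e0 He] : \forall r \near b, 0 < u r by apply: (cvgr_gt (u b) (cu b)).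
(* A point strictly after [b], close enough to keep [u] positive and not beyond [t]. *)
pose r := b + Num.min (e / 2) (t - b).
have [r1 r2] : Num.min (e / 2) (t - b) <= e / 2 /\ Num.min (e / 2) (t - b) <= t - b.
  by rewrite !ge_min !lexx orbT.
have r0 : 0 < Num.min (e / 2) (t - b) by rewrite lt_min divr_gt0 //= subr_gt0.
have : 0 < u r.
  by apply: He; rewrite /= distrC addrAC subrr add0r gtr0_norm //; lra.
by rewrite ltNge => /negP[]; rewrite subr_le0 rtL // /r; lra.
Qed.

End LipschitzCover.

(** * Barycentric coordinates and quadratic polynomials on a triangle *)

Section Triangle.
Context {R : realType}.
Implicit Types (x y v : R * R) (a : 'I_3 -> R * R).

(** Cramer's rule for the inverse of [affine_map]: the barycentric coordinates belonging to corners
    1 and 2. *)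
Definition bary a x : R * R :=
  let d := det2 (a 1 - a 0) (a 2 - a 0) in
  (det2 (x - a 0) (a 2 - a 0) / d, det2 (a 1 - a 0) (x - a 0) / d).

Lemma baryK a : det2 (a 1 - a 0) (a 2 - a 0) != 0 -> cancel (bary a) (affine_map a).
Proof.
rewrite /bary /affine_map /det2; case: (a 0) (a 1) (a 2) => [p q] [p1 q1] [p2 q2] /= d [x y] /=.
by congr pair; rewrite /= /GRing.scale /=; field.
Qed.

Lemma affine_mapK a : det2 (a 1 - a 0) (a 2 - a 0) != 0 -> cancel (affine_map a) (bary a).
Proof.
rewrite /bary /affine_map /det2; case: (a 0) (a 1) (a 2) => [p q] [p1 q1] [p2 q2] /= d [x y] /=.
by congr pair; rewrite /= /GRing.scale /=; field.
Qed.

Lemma triangleE a : det2 (a 1 - a 0) (a 2 - a 0) != 0 ->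
  affine_map a @` ref_simplex = bary a @^-1` ref_simplex.
Proof.
move=> d; apply/seteqP; split=> [_ [x Sx <-]|x Sx] /=; first by rewrite affine_mapK.
by exists (bary a x) => //; rewrite baryK.
Qed.

(** The linear part of [bary], that is, its derivative in the direction [v]. *)
Definition dbary a v : R * R :=
  let d := det2 (a 1 - a 0) (a 2 - a 0) in
  (det2 v (a 2 - a 0) / d, det2 (a 1 - a 0) v / d).

Lemma baryD a x v h : bary a (h *: v + x) = bary a x + h *: dbary a v.
Proof.
rewrite /bary /dbary /det2; case: (a 0) (a 1) (a 2) x v => [p q] [p1 q1] [p2 q2] [x y] [v w] /=.
by congr pair; rewrite /= /GRing.scale /=; ring.
Qed.

Lemma dot_continuous p : continuous (fun x => dot p x).
Proof.
move=> x; rewrite /dot; apply: cvgD; apply: cvgM; try exact: cvg_cst.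
  exact: cvg_fst.
exact: cvg_snd.
Qed.

Lemma bary_continuous a : continuous (bary a).
Proof.
pose d := det2 (a 1 - a 0) (a 2 - a 0).
have E : bary a = fun x =>
    (dot (((a 2).2 - (a 0).2) / d, - (((a 2).1 - (a 0).1) / d)) (x - a 0),
     dot (- (((a 1).2 - (a 0).2) / d), ((a 1).1 - (a 0).1) / d) (x - a 0)).
  by apply/funext => x; rewrite /bary -/d /dot {1 2}/det2; congr pair; rewrite /=; ring.
rewrite E => x; have c p : (fun y => dot p (y - a 0)) @ x --> dot p (x - a 0).
  have := @continuous_comp _ _ _ (fun y : R * R => y - a 0) (fun y => dot p y) x; apply.
    by apply: cvgB; [exact: cvg_id|exact: cvg_cst].
  exact: dot_continuous.
exact: (cvg_pair (c _) (c _)).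
Qed.

Lemma closed_ref_simplex : closed (@ref_simplex R).
Proof.
rewrite (_ : ref_simplex = dot (1, 0) @^-1` [set t | 0 <= t] `&`
   (dot (0, 1) @^-1` [set t | 0 <= t] `&` dot (1, 1) @^-1` [set t | t <= 1])); last first.
  by apply/seteqP; split=> x; rewrite /ref_simplex /dot /= !(mul0r, mul1r, addr0, add0r);
    [case|case=> ? []].
apply: closedI; [|apply: closedI];
  (apply: preimage_closed; first by move=> x _; exact: dot_continuous).
- exact: closed_ge.
- exact: closed_ge.
- exact: closed_le.
Qed.

Lemma open_ref_simplex_int : open (@ref_simplex_int R).
Proof.
rewrite (_ : ref_simplex_int = dot (1, 0) @^-1` [set t | 0 < t] `&`
   (dot (0, 1) @^-1` [set t | 0 < t] `&` dot (1, 1) @^-1` [set t | t < 1])); last first.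
  by apply/seteqP; split=> x; rewrite /ref_simplex_int /dot /= !(mul0r, mul1r, addr0, add0r);
    [case|case=> ? []].
apply: openI; [|apply: openI]; (apply: open_comp; first by move=> x _; exact: dot_continuous).
- exact: open_gt.
- exact: open_gt.
- exact: open_lt.
Qed.

Definition quad (c : nat -> R) x : R :=
  c 0%N + c 1%N * x.1 + c 2%N * x.2 + c 3%N * x.1 ^+ 2 + c 4%N * (x.1 * x.2) + c 5%N * x.2 ^+ 2.

Lemma poly_on_quad D f : poly_on 2 D f -> exists c, forall x, D x -> f x = quad c x.
Proof.
move=> [a H]; exists (fun n => nth 0 [:: a 0 0; a 1 0; a 0 1; a 2 0; a 1 1; a 0 2]%N n).
move=> x /H ->; under eq_bigr do rewrite big_mkcond !big_ord_recl big_ord0 /=.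
rewrite !big_ord_recl big_ord0 /=.
by rewrite /quad /bump /=; ring.
Qed.

Lemma poly_on_affine D f (c0 c1 c2 : R) :
  (forall x, D x -> f x = c0 + c1 * x.1 + c2 * x.2) -> poly_on 1 D f.
Proof.
move=> H; exists (fun i j => match i, j with 0, 0 => c0 | 0, _ => c2 | _, _ => c1 end)%N.
move=> x /H ->; under eq_bigr do rewrite big_mkcond !big_ord_recl big_ord0 /=.
rewrite !big_ord_recl big_ord0 /=.
by rewrite /bump /=; ring.
Qed.

Lemma quad_lipschitz c : exists2 K, 0 <= K & forall x y, ref_simplex x -> ref_simplex y ->
  `|quad c y - quad c x| <= K * (`|y.1 - x.1| + `|y.2 - x.2|).
Proof.
(* The difference factors as [A * (y.1 - x.1) + B * (y.2 - x.2)]. Coordinates on the simplex lie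
   between 0 and 1, which bounds [A] by [|c1| + 2|c3| + |c4|] and [B] by [|c2| + 2|c5| + |c4|]; the
   constant dominates both. *)
exists (`|c 1%N| + `|c 2%N| + 2 * `|c 3%N| + `|c 4%N| + 2 * `|c 5%N|).
  by rewrite !addr_ge0 // mulr_ge0.
case=> x1 x2 [y1 y2] [/= x10 x20 x12] [/= y10 y20 y12]; rewrite /quad /=.
have -> : c 0%N + c 1%N * y1 + c 2%N * y2 + c 3%N * y1 ^+ 2 + c 4%N * (y1 * y2) + c 5%N * y2 ^+ 2 -
  (c 0%N + c 1%N * x1 + c 2%N * x2 + c 3%N * x1 ^+ 2 + c 4%N * (x1 * x2) + c 5%N * x2 ^+ 2) =
  (c 1%N + c 3%N * (x1 + y1) + c 4%N * x2) * (y1 - x1) +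
  (c 2%N + c 5%N * (x2 + y2) + c 4%N * y1) * (y2 - x2) by ring.
apply: (le_trans (ler_normD _ _)); rewrite !normrM [leRHS]mulrDr.
have b (c' t K : R) : 0 <= t <= K -> `|c' * t| <= K * `|c'|.
  by move=> /andP[t0 tK]; rewrite normrM (ger0_norm t0) mulrC ler_wpM2r.
have T (p q r : R) : `|p + q + r| <= `|p| + `|q| + `|r|.
  by apply: (le_trans (ler_normD _ _)); rewrite lerD2r ler_normD.
have := normr_ge0 (c 1%N); have := normr_ge0 (c 2%N); have := normr_ge0 (c 3%N).
have := normr_ge0 (c 4%N); have := normr_ge0 (c 5%N) => n5 n4 n3 n2 n1.
apply: lerD; apply: ler_wpM2r => //; apply: (le_trans (T _ _ _)).
  have b1 : `|c 3%N * (x1 + y1)| <= 2 * `|c 3%N| by apply: b; lra.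
  have b2 : `|c 4%N * x2| <= 1 * `|c 4%N| by apply: b; lra.
  lra.
have b1 : `|c 5%N * (x2 + y2)| <= 2 * `|c 5%N| by apply: b; lra.
have b2 : `|c 4%N * y1| <= 1 * `|c 4%N| by apply: b; lra.
lra.
Qed.

(** The derivative of [quad c] at [x] in the direction [v]. *)
Definition dquad (c : nat -> R) x v : R :=
  c 1%N * v.1 + c 2%N * v.2 + 2 * c 3%N * x.1 * v.1 +
  c 4%N * (x.1 * v.2 + v.1 * x.2) + 2 * c 5%N * x.2 * v.2.

(** The exact Taylor expansion; the coefficient of [h ^+ 2] is the homogeneous quadratic part of
    [quad c] at [v]. *)
Lemma quadD c x v h :
  quad c (x + h *: v) = quad c x + dquad c x v * h +
    (quad c v - c 0%N - c 1%N * v.1 - c 2%N * v.2) * h ^+ 2.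
Proof.
by case: x v => x y [v w]; rewrite /quad /dquad /= /GRing.scale /=; ring.
Qed.

Lemma derive_quadratic (f : R * R -> R) (A B : R) x v (g : R * R -> R) :
  {near x, f =1 g} -> (forall h, g (h *: v + x) = g x + A * h + B * h ^+ 2) ->
  derivable f x v /\ 'D_v f x = A.
Proof.
move=> fg gE.
suff [dg Dg] : derivable g x v /\ 'D_v g x = A.
  split; last by rewrite (near_eq_derive v fg).
  by apply: near_eq_derivable dg; apply: filterS fg => y.
have H : h^-1 *: ((g \o shift x) (h *: v) - g x) @[h --> 0^'] --> A.
  have : (fun h => A + B * h) @ 0^' --> A + B * 0.
    apply: cvg_within_filter; apply: cvgD; first exact: cvg_cst.
    by apply: cvgM; [exact: cvg_cst|exact: cvg_id].
  rewrite mulr0 addr0; apply: cvg_trans; apply: near_eq_cvg.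
  near=> h; have h0 : h != 0 by near: h; exact: nbhs_dnbhs_neq.
  rewrite /= gE; rewrite /GRing.scale /=; field; exact: h0.
split; first by apply/cvg_ex; exists A.
exact: cvg_lim H.
Unshelve. all: by end_near. Qed.

End Triangle.

(** Serves for the family of all triangle boundaries, indexed by a cell and two integer lattice
    coordinates. *)
Lemma negligible_bigcup_count d (T : sigmaRingType d) (R : realFieldType)
    (mu : {measure set T -> \bar R}) (I : countType) (F : I -> set T) :
  (forall i, mu.-negligible (F i)) -> mu.-negligible (\bigcup_i F i).
Proof.
move=> FN; pose G k := oapp F set0 (unpickle k).
apply: (@negligibleS _ _ _ _ (\bigcup_k G k)).
  by move=> x [i _ Fx]; exists (pickle i) => //; rewrite /G pickleK.
by apply: negligible_bigcup => k; rewrite /G; case: unpickle => //=; exact: negligible_set0.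
Qed.

(** * Local finiteness of the periodic mesh and global Lipschitz bounds *)

Section Mesh.
Context {R : realType} (M : periodic_mesh R).
Local Notation R2 := (measurableTypeR R * measurableTypeR R)%type.
Implicit Types (x v l : R * R).

Let nd K := @elt_nondegenerate R M K.

Definition lpt (m n : int) : R * R := per1 M *~ m + per2 M *~ n.

Lemma lptE m n : lpt m n = m%:~R *: per1 M + n%:~R *: per2 M.
Proof. by rewrite /lpt !scaler_int. Qed.

Lemma lattice_lpt m n : lattice (per1 M) (per2 M) (lpt m n).
Proof. by exists m, n. Qed.

Lemma lattice_shift (V : Type) (f : R * R -> V) x m n : Defs.periodic M f -> f (x - lpt m n) = f x.
Proof.
by move=> pf; have := pf (x - lpt m n) _ (lattice_lpt m n); rewrite subrK.
Qed.

Lemma cover_bary x : exists (K : elt M) m n, ref_simplex (bary (corner K) (x - lpt m n)).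
Proof.
have [K [l [[m [n ->]]]]] := @elts_cover R M x.
by rewrite (triangleE (nd K)) => H; exists K, m, n.
Qed.

Lemma elt_bounded : exists2 D, 0 <= D &
  forall (K : elt M) x, ref_simplex (bary (corner K) x) -> square D x.
Proof.
(* [S a] bounds both coordinates on the triangle [a], written as a corner plus multiples in [0, 1]
   of two edge vectors. Summing over the finitely many cells gives a uniform bound. *)
pose S (a : 'I_3 -> R * R) : R := `|(a 0).1| + `|(a 0).2| +
  `|(a 1 - a 0).1| + `|(a 1 - a 0).2| + `|(a 2 - a 0).1| + `|(a 2 - a 0).2|.
have S0 a : 0 <= S a by rewrite !addr_ge0.
exists (\sum_(K : elt M) S (corner K)); first exact: sumr_ge0.
move=> K x; rewrite -{2}(baryK (nd K) x).
case: (bary _ _) => s t [/= s0 t0 st].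
have SK : S (corner K) <= \sum_(K : elt M) S (corner K).
  by rewrite (bigD1 K) //= lerDl sumr_ge0.
have tri (p q r : R) : `|p + s * q + t * r| <= `|p| + `|q| + `|r|.
  apply: (le_trans (ler_normD _ _)); apply: lerD.
    apply: (le_trans (ler_normD _ _)); rewrite lerD2l normrM ler_piMl // ger0_norm //; lra.
  by rewrite normrM ler_piMl // ger0_norm //; lra.
have := normr_ge0 (corner K 0).1; have := normr_ge0 (corner K 0).2.
have := normr_ge0 (corner K 1 - corner K 0).1; have := normr_ge0 (corner K 1 - corner K 0).2.
have := normr_ge0 (corner K 2 - corner K 0).1; have := normr_ge0 (corner K 2 - corner K 0).2.
move=> n1 n2 n3 n4 n5 n6.
split; apply: (le_trans _ SK); apply: (le_trans (tri _ _ _)); rewrite /S; lra.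
Qed.

(** By Cramer's rule each integer coordinate times the determinant of the periods is a determinant
    involving the lattice vector. *)
Lemma lattice_coord_bound E m n : square E (lpt m n) ->
  let C := E * (`|(per1 M).1| + `|(per1 M).2| + `|(per2 M).1| + `|(per2 M).2|) /
    `|det2 (per1 M) (per2 M)| in
  `|m|%:~R <= C /\ `|n|%:~R <= C.
Proof.
move=> [l1 l2] C.
have d0 := @periods_free R M.
have d1 : 0 < `|det2 (per1 M) (per2 M)| by rewrite normr_gt0.
have mE : m%:~R * det2 (per1 M) (per2 M) = det2 (lpt m n) (per2 M).
  by rewrite lptE /det2 /= /GRing.scale /=; ring.
have nE : n%:~R * det2 (per1 M) (per2 M) = det2 (per1 M) (lpt m n).
  by rewrite lptE /det2 /= /GRing.scale /=; ring.
have E0 : 0 <= E by apply: le_trans l1.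
have b (p q p' q' : R) : `|p| <= E -> `|q| <= E -> `|p * p' - q * q'| <= E * (`|p'| + `|q'|).
  move=> pE qE; apply: (le_trans (ler_normB _ _)); rewrite !normrM mulrDr.
  by apply: lerD; apply: ler_wpM2r.
rewrite /C !ler_pdivlMr // !intr_norm -!normrM mE nE.
have -> : det2 (per1 M) (lpt m n) = (lpt m n).2 * (per1 M).1 - (lpt m n).1 * (per1 M).2.
  by rewrite /det2; ring.
rewrite /det2; split.
    apply: (le_trans (b _ _ _ _ l1 l2)); rewrite ler_wpM2l //.
  by have := normr_ge0 (per1 M).1; have := normr_ge0 (per1 M).2; lra.
apply: (le_trans (b _ _ _ _ l2 l1)); rewrite ler_wpM2l //.
by have := normr_ge0 (per2 M).1; have := normr_ge0 (per2 M).2; lra.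
Qed.

(** If [x] lies in a translated cell, the translation is [x] minus a point of the original cell and
    hence bounded, so finitely many translations suffice. The ordinals [i] below [2N + 1] encode the
    integers [i - N] from [-N] to [N]. *)
Lemma cover_finite B : exists N : nat, forall x, square B x ->
  exists (K : elt M) (i j : 'I_N.*2.+1),
    ref_simplex (bary (corner K) (x - lpt (i%:Z - N%:Z) (j%:Z - N%:Z))).
Proof.
have [D D0 HD] := elt_bounded.
pose C := (B + D) * (`|(per1 M).1| + `|(per1 M).2| + `|(per2 M).1| + `|(per2 M).2|) /
    `|det2 (per1 M) (per2 M)|.
exists (Num.truncn C).+1 => x [B1 B2].
have [K [m [n Hx]]] := cover_bary x; have [D1 D2] := HD _ _ Hx.
have [mC nC] : `|m|%:~R <= C /\ `|n|%:~R <= C.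
  apply: lattice_coord_bound; split.
    rewrite (_ : (lpt m n).1 = x.1 - (x - lpt m n).1); last by rewrite /= subKr.
    by apply: (le_trans (ler_normB _ _)); rewrite lerD.
  rewrite (_ : (lpt m n).2 = x.2 - (x - lpt m n).2); last by rewrite /= subKr.
  by apply: (le_trans (ler_normB _ _)); rewrite lerD.
set N := (Num.truncn C).+1.
have ordP (k : int) : `|k|%:~R <= C -> exists i : 'I_N.*2.+1, i%:Z - N%:Z = k.
  move=> kC; have kN : (`|k| < N)%N.
    by rewrite -(ltr_nat R) natr_absz; exact: le_lt_trans (truncnS_gt C).
  have H : (absz (k + N%:Z)%R < N.*2.+1)%N by lia.
  exists (Ordinal H) => /=; lia.
have [i iE] := ordP m mC; have [j jE] := ordP n nC.
by exists K, i, j; rewrite iE jE.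
Qed.

Section Quadratic.
Context (f : R * R -> R) (fP : Ph M f).

(** Periodicity lets one polynomial per cell serve all its lattice translates, so only finitely many
    coefficient families occur. *)
Lemma elt_quad : exists c : elt M -> nat -> R, forall K x m n,
  ref_simplex (bary (corner K) (x - lpt m n)) -> f x = quad (c K) (bary (corner K) (x - lpt m n)).
Proof.
have [_ pf qf] := fP.
have [c Hc] := choice (fun K => poly_on_quad (qf K)).
exists c => K x m n Hx; rewrite -(lattice_shift x m n pf) -Hc //=.
by rewrite /elt_map baryK //; exact: nd.
Qed.

(** On every translate of a cell the quadratic has the same Lipschitz constant along [v]. A segment
    meets finitely many translates, and [lipschitz_cover] glues the bounds with a constant
    independent of the segment. *)
Lemma lagrange2_lipschitz v : exists L, forall x h, `|f (h *: v + x) - f x| <= L * `|h|.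
Proof.
have [cf pf _] := fP; have [c Hc] := elt_quad.
have [Kq Kq_ge0 HK] : exists2 Kq : elt M -> R, forall K, 0 <= Kq K &
  forall K x y, ref_simplex x -> ref_simplex y ->
  `|quad (c K) y - quad (c K) x| <= Kq K * (`|y.1 - x.1| + `|y.2 - x.2|).
  have [Kq H] := choice (fun K => let: ex_intro2 k k0 kL := quad_lipschitz (c K) in
    ex_intro (fun k => 0 <= k /\ forall x y, ref_simplex x -> ref_simplex y ->
  `|quad (c K) y - quad (c K) x| <= k * (`|y.1 - x.1| + `|y.2 - x.2|)) k (conj k0 kL)).
  by exists Kq => K; have [] := H K.
pose be (K : elt M) := dbary (corner K) v.
pose LK K := Kq K * (`|(be K).1| + `|(be K).2|).
have LK0 K : 0 <= LK K by rewrite mulr_ge0 // addr_ge0.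
pose L := \sum_K LK K.
have LKL K : LK K <= L by rewrite /L (bigD1 K) //= lerDl sumr_ge0.
suff H x s t : s <= t -> `|f (t *: v + x) - f (s *: v + x)| <= L * (t - s).
  exists L => x h; have [h0|h0] := leP 0 h.
    by have := H x 0 h h0; rewrite scale0r add0r subr0 (ger0_norm h0).
  by have := H x h 0 (ltW h0); rewrite scale0r add0r sub0r distrC (ltr0_norm h0).
move=> st.
have cl : continuous (fun r : R => r *: v + x).
  by move=> r; apply: cvgD; [apply: cvgZr_tmp|exact: cvg_cst].
(* The square is large enough to contain the segment from [s *: v + x] to [t *: v + x]. Only [N]
   depends on the segment, not [L]. *)
have [N HN] := cover_finite ((`|s| + `|t|) * (`|v.1| + `|v.2|) + `|x.1| + `|x.2|).
pose F (k : elt M * 'I_N.*2.+1 * 'I_N.*2.+1) : set R :=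
  [set r | ref_simplex (bary (corner k.1.1) (r *: v + x - lpt (k.1.2%:Z - N%:Z) (k.2%:Z - N%:Z)))].
apply: (@lipschitz_cover _ _ F (fun r => f (r *: v + x))) => //.
- by move=> r; apply: (@continuous_comp _ _ _ (fun r : R => r *: v + x) f); [exact: cl|exact: cf].
- move=> k; rewrite /F; apply: (@preimage_closed _ _
    (fun r : R => bary (corner k.1.1) (r *: v + x - lpt _ _)) (@ref_simplex R)); last exact: closed_ref_simplex.
  move=> r _; apply: (@continuous_comp _ _ _ (fun r : R => r *: v + x - lpt _ _) (bary _)).
    by apply: cvgB; [exact: cl|exact: cvg_cst].
  exact: bary_continuous.
- move=> [[K i] j] p q; rewrite /F /= => Fp Fq.
  rewrite (Hc _ _ _ _ Fp) (Hc _ _ _ _ Fq).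
  apply: (le_trans (HK K _ _ Fp Fq)); rewrite -!addrA.
  move: (x - lpt _ _) => y.
  have [-> ->] :
      (bary (corner K) (q *: v + y)).1 - (bary (corner K) (p *: v + y)).1 = (q - p) * (be K).1 /\
      (bary (corner K) (q *: v + y)).2 - (bary (corner K) (p *: v + y)).2 = (q - p) * (be K).2.
    rewrite !baryD -/(be K); case: (bary _ y) (be K) => ? ? [? ?] /=.
    by rewrite /GRing.scale /=; split; ring.
  apply: le_trans (ler_wpM2r (normr_ge0 _) (LKL K)).
  by rewrite /LK !normrM; rewrite le_eqVlt; apply/orP; left; apply/eqP; ring.
- move=> r /andP[sr rt]; have [|K [i [j Hr]]] := HN (r *: v + x); last by exists (K, i, j).
  have rB : `|r| <= `|s| + `|t|.
    rewrite ler_norml; have := ler_norm t; have := ler_norm (- s); rewrite normrN.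
    by have := normr_ge0 s; have := normr_ge0 t; move=> *; apply/andP; split; lra.
  have n1 := normr_ge0 v.1; have n2 := normr_ge0 v.2.
  have n3 := normr_ge0 x.1; have n4 := normr_ge0 x.2.
  split; apply: (le_trans (ler_normD _ _)); rewrite normrM.
  - have : `|r| * `|v.1| <= (`|s| + `|t|) * (`|v.1| + `|v.2|) by apply: ler_pM => //; lra.
    lra.
  - have : `|r| * `|v.2| <= (`|s| + `|t|) * (`|v.1| + `|v.2|) by apply: ler_pM => //; lra.
    lra.
Qed.

End Quadratic.
End Mesh.

(** * Gradients of piecewise quadratics belong to the curl-conforming space *)

Section Gradient.
Context {R : realType} (M : periodic_mesh R).
Local Notation R2 := (measurableTypeR R * measurableTypeR R)%type.
Implicit Types (x v l : R * R).

Let nd K := @elt_nondegenerate R M K.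

Lemma measurable_elt (K : elt M) : measurable (elt_map K @` ref_simplex : set R2).
Proof.
rewrite /elt_map (triangleE (nd K)); apply: closed_measurable2.
apply: preimage_closed; last exact: closed_ref_simplex.
by move=> x _; exact: bary_continuous.
Qed.

Lemma Omega_measurable : measurable (Omega M : set R2).
Proof.
rewrite (_ : Omega M = \big[setU/set0]_(K : elt M) (elt_map K @` ref_simplex)).
  by apply: bigsetU_measurable => K _; exact: measurable_elt.
apply/seteqP; split=> [x [K HK]|x].
  by rewrite (bigD1 K) //=; left.
by rewrite -bigcup_seq => -[K _ HK]; exists K.
Qed.

Lemma Omega_bounded : exists r, Omega M `<=` square r.
Proof.
have [D _ HD] := elt_bounded M; exists D => x [K].
by rewrite /elt_map (triangleE (nd K)); exact: HD.
Qed.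

Lemma L2inner_integrable (F G : R * R -> R * R) :
  L2loc (fun x => (F x).1) -> L2loc (fun x => (F x).2) ->
  L2loc (fun x => (G x).1) -> L2loc (fun x => (G x).2) ->
  (leb2 R).-integrable (Omega M) (EFin \o (fun x => dot (F x) (G x))).
Proof.
move=> F1 F2 G1 G2; have [r Or] := Omega_bounded.
apply: (integrableS (measurable_square r) Omega_measurable Or).
have := integrableD (measurable_square r) (L2loc_integrableM r F1 G1) (L2loc_integrableM r F2 G2).
exact.
Qed.

Lemma closed_line (p : R * R) (q : R) : closed [set x : R * R | dot p x = q].
Proof.
apply: (@preimage_closed _ _ (fun x => dot p x) [set t | t = q]); last exact: closed_eq.
by move=> x _; exact: dot_continuous.
Qed.

Lemma negligible_line (p : R * R) q : p != 0 ->
  (leb2 R).-negligible [set x | dot p x = q].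
Proof.
move=> p0; apply/negligibleP; last exact: leb2_line.
by apply: closed_measurable2; exact: closed_line.
Qed.

Lemma negligible_edges (K : elt M) l : (leb2 R).-negligible
  [set x | ref_simplex (bary (corner K) (x - l)) /\ ~ ref_simplex_int (bary (corner K) (x - l))].
Proof.
have := nd K; move: (corner K) => a d.
pose e1 := a 1 - a 0; pose e2 := a 2 - a 0.
(* Normals of the edge lines: [dot p1 x] is [det2 x e2], [dot p2 x] is [det2 e1 x], and their sum
   describes the edge opposite corner 0. Each is nonzero because the triangle is nondegenerate. *)
pose p1 : R * R := (e2.2, - e2.1); pose p2 : R * R := (- e1.2, e1.1).
pose p3 : R * R := p1 + p2.
have [n1 n2 n3] : [/\ p1 != 0, p2 != 0 & p3 != 0].
  rewrite /p3 /p1 /p2; move: d; rewrite -/e1 -/e2 /det2; case: (e1) (e2) => [u1 u2] [w1 w2] /= d.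
  split; apply: contra_neq d => -[] => ? ?.
  - have -> : w1 = 0 by lra.
    have -> : w2 = 0 by lra.
    by ring.
  - have -> : u1 = 0 by lra.
    have -> : u2 = 0 by lra.
    by ring.
  - have -> : w1 = u1 by lra.
    have -> : w2 = u2 by lra.
    by ring.
pose q p := dot p (l + a 0).
have H := negligibleU (negligibleU (negligible_line (q p1) n1) (negligible_line (q p2) n2))
  (negligible_line (det2 e1 e2 + q p3) n3).
apply: negligibleS H => x /= [[x1 x2 x3]] nx; apply: contrapT => no; apply: nx.
have dd : det2 e1 e2 != 0 by [].
split; rewrite lt_neqAle ?x1 ?x2 ?x3 andbT.
- apply/eqP => E; apply: no; left; left.
  have : det2 (x - l - a 0) e2 = 0.
    move: E; rewrite /bary /= -/e1 -/e2 => /esym/eqP.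
    by rewrite mulf_eq0 invr_eq0 (negbTE dd) orbF => /eqP.
  by rewrite /q /dot /p1 /det2 /= => ?; lra.
- apply/eqP => E; apply: no; left; right.
  have : det2 e1 (x - l - a 0) = 0.
    move: E; rewrite /bary /= -/e1 -/e2 => /esym/eqP.
    by rewrite mulf_eq0 invr_eq0 (negbTE dd) orbF => /eqP.
  by rewrite /q /dot /p2 /det2 /= => ?; lra.
- apply/eqP => E; apply: no; right.
  have : det2 (x - l - a 0) e2 + det2 e1 (x - l - a 0) = det2 e1 e2.
    move: E; rewrite /bary /= -/e1 -/e2 -mulrDl => /(congr1 (fun z => z * det2 e1 e2)).
    by rewrite divfK // mul1r.
  by rewrite /q /dot /p3 /p1 /p2 /det2 /= => ?; lra.
Qed.

Section Quadratic.
Context (f : R * R -> R) (fP : Ph M f).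

(** An interior point of a translated cell has a neighbourhood on which [f] is a single quadratic in
    barycentric coordinates. *)
Lemma lagrange2_derive : exists c : elt M -> nat -> R, forall K x m n,
  ref_simplex_int (bary (corner K) (x - lpt M m n)) -> forall v,
  derivable f x v /\
  'D_v f x = dquad (c K) (bary (corner K) (x - lpt M m n)) (dbary (corner K) v).
Proof.
have [c Hc] := elt_quad fP; exists c => K x m n Hx v.
pose a := corner K; pose l := lpt M m n; pose w := dbary a v.
pose g y := quad (c K) (bary a (y - l)).
apply: (@derive_quadratic _ _ _ (quad (c K) w - c K 0%N - c K 1%N * w.1 - c K 2%N * w.2) _ _ g).
  have N : \forall y \near x, ref_simplex_int (bary a (y - l)).
    apply: open_nbhs_nbhs; split => //.
    change (open ((fun y => bary a (y - l)) @^-1` @ref_simplex_int R)).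
    apply: open_comp; last exact: open_ref_simplex_int.
    move=> y _; have := @continuous_comp _ _ _ (fun z : R * R => z - l) (bary a) y; apply.
      by apply: cvgB; [exact: cvg_id|exact: cvg_cst].
    exact: bary_continuous.
  apply: filterS N => y [y1 y2 y3]; rewrite /g (Hc K y m n) //.
  by split; exact: ltW.
by move=> h; rewrite /g -addrA baryD quadD.
Qed.

Lemma lagrange2_derivable_ae :
  (leb2 R).-negligible [set x | ~ (derivable f x (1, 0) /\ derivable f x (0, 1))].
Proof.
have [c Hc] := lagrange2_derive.
pose E (i : elt M * int * int) := [set x |
  ref_simplex (bary (corner i.1.1) (x - lpt M i.1.2 i.2)) /\
  ~ ref_simplex_int (bary (corner i.1.1) (x - lpt M i.1.2 i.2))].
have EN i : (leb2 R).-negligible (E i) by exact: negligible_edges.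
apply: negligibleS (negligible_bigcup_count EN) => x /= nx.
have [K [m [n Hx]]] := cover_bary M x; exists (K, m, n) => //; split => //= Hi.
by apply: nx; split; exact: (Hc _ _ _ _ Hi _).1.
Qed.

(** A limit of difference quotients inherits the Lipschitz bound; where there is no limit, the
    derivative is 0 by default. The bound therefore holds on the skeleton as well. *)
Lemma lagrange2_bounded_derive v : exists C, forall x, `|'D_v f x| <= C.
Proof.
have [L HL] := lagrange2_lipschitz fP v.
exists L => x; pose q (h : R) := h^-1 *: ((f \o shift x) (h *: v) - f x).
rewrite (_ : 'D_v f x = lim (q h @[h --> 0^'])) //.
have [/cvg_ex[/= l ql]|nq] := pselect (cvg (q h @[h --> 0^'])); last first.
  by rewrite dvgP // normr0; have := HL x 1; rewrite normr1 mulr1; exact: le_trans.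
rewrite (cvg_lim _ ql) //; apply: (cvgr_to_le (cvg_norm ql)).
near=> h; have h0 : h != 0 by near: h; exact: nbhs_dnbhs_neq.
by rewrite normrZ normfV ler_pdivrMl ?normr_gt0 // mulrC; exact: HL.
Unshelve. all: by end_near. Qed.

Lemma periodic_derive v : Defs.periodic M ('D_v f).
Proof.
have [_ pf _] := fP => x l ll; apply: (congr1 (fun F : R -> R => lim (F @ 0^'))).
by apply/funext => h /=; rewrite addrA !(pf _ _ ll).
Qed.

Lemma grad_Hh : Hh M (grad f) /\ weak_curl (grad f) (fun=> 0).
Proof.
have [cf pf _] := fP.
have [L1 HL1] := lagrange2_lipschitz fP (1, 0).
have [L2 HL2] := lagrange2_lipschitz fP (0, 1).
have wc : weak_curl (grad f) (fun=> 0).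
  apply: (@weak_curl_grad _ _ (Num.max L1 L2)) => //.
  - by move=> x h; apply: (le_trans (HL1 x h)); rewrite ler_wpM2r // le_max lexx.
  - by move=> x h; apply: (le_trans (HL2 x h)); rewrite ler_wpM2r // le_max lexx orbT.
  - exact: lagrange2_derivable_ae.
split=> //; split.
  split.
  - by move=> x l ll; rewrite /grad pd1E pd2E !periodic_derive.
  - rewrite /grad /= pd1E; have [C HC] := lagrange2_bounded_derive (1, 0).
    by apply: L2loc_bounded HC; exact: measurable_derive.
  - rewrite /grad /= pd2E; have [C HC] := lagrange2_bounded_derive (0, 1).
    by apply: L2loc_bounded HC; exact: measurable_derive.
  - by exists (fun=> 0).
move=> K; have [c Hc] := lagrange2_derive.
(* By the chain rule the pullback of the gradient is the gradient of the pulled-back quadratic,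
   hence affine in each component. *)
have E x : ref_simplex_int x ->
    pullback K (grad f) x = (c K 1%N + 2 * c K 3%N * x.1 + c K 4%N * x.2,
                             c K 2%N + c K 4%N * x.1 + 2 * c K 5%N * x.2).
  move=> Hx; rewrite /pullback /grad pd1E pd2E.
  have Hx' : ref_simplex_int (bary (corner K) (elt_map K x - lpt M 0 0)).
    by rewrite /lpt !mulr0z addr0 subr0 /elt_map (affine_mapK (nd K)).
  rewrite (Hc _ _ _ _ Hx' _).2 (Hc _ _ _ _ Hx' _).2.
  rewrite /lpt !mulr0z addr0 subr0 /elt_map (affine_mapK (nd K)).
  move: (nd K); rewrite /dquad /dbary /dot /det2.
  case: (corner K 1 - _) (corner K 2 - _) => [p q] [r s] /= d.
  by congr pair; field.
split.
  by apply: (@poly_on_affine _ _ _ (c K 1%N) (2 * c K 3%N) (c K 4%N)) => x /E ->.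
by apply: (@poly_on_affine _ _ _ (c K 2%N) (c K 4%N) (2 * c K 5%N)) => x /E ->.
Qed.

End Quadratic.
End Gradient.

(** * Linear structure of the discrete spaces *)

Section Spaces.
Context {R : realType}.
Local Notation R2 := (measurableTypeR R * measurableTypeR R)%type.
Implicit Types (Z W : R * R -> R * R) (f g c : R * R -> R).

(** Linearity of the distributional curl; local square integrability against bounded, compactly
    supported test functions makes every split integral finite. *)
Lemma weak_curl_half_sum Z W c d :
  L2loc (fun x => (Z x).1) -> L2loc (fun x => (Z x).2) ->
  L2loc (fun x => (W x).1) -> L2loc (fun x => (W x).2) ->
  weak_curl Z c -> weak_curl W d ->
  weak_curl (fun x => 2^-1 *: (Z x + W x)) (fun x => 2^-1 * (c x + d x)).
Proof.
move=> Z1 Z2 W1 W2 [cL cE] [dL dE]; split; first exact: L2loc_half_sum.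
move=> phi tphi; have [r [C [cp c1 c2 S [_ pC p1C p2C]]]] := test_fun_bounds tphi.
pose I f := (leb2 R).-integrable setT (EFin \o f).
have p0 x : ~ square r x -> phi x = 0 by case/S.
have p10 x : ~ square r x -> pd1 phi x = 0 by case/S.
have p20 x : ~ square r x -> pd2 phi x = 0 by case/S.
have i0 f : L2loc f -> I (fun x => f x * phi x).
  by move=> fL; apply: (L2loc_integrable_test fL _ pC p0); exact: continuous_measurable2.
have i1 f : L2loc f -> I (fun x => f x * pd1 phi x).
  by move=> fL; apply: (L2loc_integrable_test fL _ p1C p10); exact: continuous_measurable2.
have i2 f : L2loc f -> I (fun x => f x * pd2 phi x).
  by move=> fL; apply: (L2loc_integrable_test fL _ p2C p20); exact: continuous_measurable2.
have iB f g : I f -> I g -> I (fun x => f x - g x).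
  by move=> fi gi; have := integrableB measurableT fi gi; exact.
have iD f g : I f -> I g -> I (fun x => f x + g x).
  by move=> fi gi; have := integrableD measurableT fi gi; exact.
have half f g h : (forall x, h x = 2^-1 * (f x + g x)) -> I f -> I g ->
    integral2 setT h = 2^-1 * (integral2 setT f + integral2 setT g).
  move=> hE fi gi; rewrite /integral2 -RintegralD // -RintegralZl //; last exact: iD.
  by apply: eq_Rintegral => x _; rewrite hE.
rewrite (half (fun x => c x * phi x) (fun x => d x * phi x)); last 3 first.
- by move=> x; ring.
- exact: i0.
- exact: i0.
rewrite cE // dE //; symmetry; apply: half => [x||].
- by rewrite /= /GRing.scale /=; ring.
- by apply: iB; [exact: i2|exact: i1].
- by apply: iB; [exact: i2|exact: i1].
Qed.

Lemma poly_on_lin k D f g a : poly_on k D f -> poly_on k D g ->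
  poly_on k D (fun x => a * f x + g x).
Proof.
move=> [p fp] [q gq]; exists (fun i j => a * p i j + q i j) => x Dx.
rewrite fp // gq // mulr_sumr -big_split; apply: eq_bigr => i _ /=.
rewrite mulr_sumr -big_split; apply: eq_bigr => j _ /=; ring.
Qed.

Lemma poly_on0 k D : poly_on k D (fun=> 0 : R).
Proof.
exists (fun _ _ => 0) => x _; rewrite big1 // => i _; rewrite big1 // => j _.
by rewrite !mul0r.
Qed.

Lemma poly_on_half_sum k D f g : poly_on k D f -> poly_on k D g ->
  poly_on k D (fun x => 2^-1 * (f x + g x)).
Proof.
move=> fp gp; have := poly_on_lin 2^-1 fp (poly_on_lin 2^-1 gp (poly_on0 k D)).
by move=> [a H]; exists a => x Dx; rewrite -H //; ring.
Qed.

Context (M : periodic_mesh R).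

Lemma lagrange_lin k f g a : Defs.lagrange M k f -> Defs.lagrange M k g ->
  Defs.lagrange M k (fun x => a * f x + g x).
Proof.
move=> [cf pf qf] [cg pg qg]; split.
- move=> x; apply: cvgD; last exact: cg.
  by apply: cvgM; [exact: cvg_cst|exact: cf].
- by move=> x l ll; rewrite (pf _ _ ll) (pg _ _ ll).
- by move=> K; exact: poly_on_lin (qf K) (qg K).
Qed.

Lemma lagrange0 k : Defs.lagrange M k (fun=> 0).
Proof.
split=> [x|//|K]; first exact: cvg_cst.
exact: poly_on0.
Qed.

Lemma lagrange_sum k (I : finType) (phi : I -> R * R -> R) (a : I -> R) :
  (forall i, Defs.lagrange M k (phi i)) -> Defs.lagrange M k (fun x => \sum_i a i * phi i x).
Proof.
move=> Hphi; elim: (index_enum I) => [|i r IH].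
  by under eq_fun do rewrite big_nil; exact: lagrange0.
by under eq_fun do rewrite big_cons; exact: lagrange_lin.
Qed.

Lemma lagrange_half_sum k f g : Defs.lagrange M k f -> Defs.lagrange M k g ->
  Defs.lagrange M k (fun x => 2^-1 * (f x + g x)).
Proof.
move=> fL gL; have := lagrange_lin 2^-1 fL (lagrange_lin 2^-1 gL (lagrange0 k)).
by under eq_fun do rewrite addr0 -mulrDr.
Qed.

(** Makes the midpoint field an admissible test field in the induction equation. *)
Lemma Hh_half_sum Z W : Hh M Z -> Hh M W -> Hh M (fun x => 2^-1 *: (Z x + W x)).
Proof.
move=> [[pZ Z1 Z2 [c wc]] qZ] [[pW W1 W2 [d wd]] qW]; split.
  split.
  - by move=> x l ll; rewrite (pZ _ _ ll) (pW _ _ ll).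
  - exact: L2loc_half_sum.
  - exact: L2loc_half_sum.
  - by exists (fun x => 2^-1 * (c x + d x)); exact: weak_curl_half_sum.
move=> K; have [q1 q2] := qZ K; have [r1 r2] := qW K.
have E x : pullback K (fun x => 2^-1 *: (Z x + W x)) x =
    (2^-1 * ((pullback K Z x).1 + (pullback K W x).1),
     2^-1 * ((pullback K Z x).2 + (pullback K W x).2)).
  by rewrite /pullback /dot /= /GRing.scale /=; congr pair; ring.
by under eq_fun do rewrite E; under [X in _ /\ poly_on _ _ X]eq_fun do rewrite E;
  split; exact: poly_on_half_sum.
Qed.

End Spaces.

(** * Invariants of the source step *)

Section Scheme.
Context {R : realType} (M : periodic_mesh R) (phi : vtx M -> R * R -> R).
Context (hphi : nodal_basis phi).
Implicit Types (U V : vtx M -> state R) (H : R * R -> R * R).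

Lemma interp_node (a : vtx M -> R) i : interp phi a (node i) = a i.
Proof.
rewrite /interp (bigD1 i) //= hphi.2 eqxx mulr1 big1 ?addr0 // => j ji.
by rewrite hphi.2 (negbTE ji) mulr0.
Qed.

Lemma interp2_node (a : vtx M -> R * R) i : interp2 phi a (node i) = a i.
Proof.
rewrite /interp2 (bigD1 i) //= hphi.2 eqxx scale1r big1 ?addr0 // => j ji.
by rewrite hphi.2 (negbTE ji) scale0r.
Qed.

Lemma interp2_Vh2 (a : vtx M -> R * R) : Vh2 M (interp2 phi a).
Proof.
have E x : interp2 phi a x = (\sum_i (a i).1 * phi i x, \sum_i (a i).2 * phi i x).
  rewrite /interp2; elim: (index_enum _) => [|i r IH]; first by rewrite !big_nil.
  by rewrite !big_cons IH; congr pair; rewrite /= /GRing.scale /= mulrC.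
by split; under eq_fun do rewrite E; apply: lagrange_sum; exact: hphi.1.
Qed.

Context (mu tau : R) (U U' : vtx M -> state R) (H H' : R * R -> R * R).
Context (hH : Hh M H) (hsrc : source_update phi mu U H tau U' H').

Lemma source_density i : density (U' i) = density (U i).
Proof. by have [u' [_ _ _ _ /(_ i)[]]] := hsrc. Qed.

Lemma source_internal_energy i : internal_energy (U' i) = internal_energy (U i).
Proof.
have [u' [_ _ _ _ /(_ i)[_ _ E]]] := hsrc.
by rewrite /internal_energy E addrK.
Qed.

Let L1 Z : Hh M Z -> L2loc (fun x => (Z x).1). Proof. by case=> -[]. Qed.
Let L2 Z : Hh M Z -> L2loc (fun x => (Z x).2). Proof. by case=> -[]. Qed.

Lemma source_energy : (forall i, 0 < density (U i)) ->
  \sum_i mass phi i * energy (U' i) + mu / 2 * L2inner M H' H' =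
  \sum_i mass phi i * energy (U i) + mu / 2 * L2inner M H H.
Proof.
move=> rho0; have [u' [Vu' hH' mom mag upd]] := hsrc.
set u := interp2 _ _ in mom mag.
pose Hm x := 2^-1 *: (H x + H' x).
have hHm : Hh M Hm by exact: Hh_half_sum.
have [c wc] : exists c, weak_curl Hm c by case: hHm => -[].
pose um x := 2^-1 *: (u x + u' x).
have Vum : Vh2 M um.
  have [V1 V2] := interp2_Vh2 (fun i => (density (U i))^-1 *: momentum (U i)).
  have [V3 V4] := Vu'.
  by split; apply: lagrange_half_sum.
have := mom um c Vum wc; have := mag Hm c hHm wc.
(* The coupling term [X] is literally the same in both equations because one version [c] of the curl
   of the midpoint field is used in both. *)
set X := L2inner _ _ um => magE momE.
have iH : (leb2 R).-integrable (Omega M) (EFin \o (fun x => dot (H x) (H x))).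
  by apply: L2inner_integrable; [exact: L1|exact: L2|exact: L1|exact: L2].
have iH' : (leb2 R).-integrable (Omega M) (EFin \o (fun x => dot (H' x) (H' x))).
  by apply: L2inner_integrable; [exact: L1|exact: L2|exact: L1|exact: L2].
have mO := Omega_measurable M.
(* Pointwise, [H' - H] dotted with the midpoint is half the difference of the squared norms. *)
have magE' : L2inner M (fun x => H' x - H x) Hm = 2^-1 * (L2inner M H' H' - L2inner M H H).
  rewrite /L2inner /integral2 -RintegralB // -RintegralZl //; last first.
    by have := integrableB mO iH' iH; exact.
  by apply: eq_Rintegral => x _; rewrite /Hm /dot /= /GRing.scale /=; ring.
(* At each node the total energy changes by the kinetic energy alone, and [rho (u' - u)] dotted with
   the midpoint velocity is this change. Positive density allows the division by [rho]. *)
have kin : \sum_i mass phi i * energy (U' i) = \sum_i mass phi i * energy (U i) +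
    lumped phi (interp phi (fun i => density (U i))) (fun x => u' x - u x) um.
  rewrite /lumped -big_split; apply: eq_bigr => i _ /=.
  have [e1 e2 ->] := upd i; rewrite e2 e1.
  rewrite interp_node /um /u interp2_node.
  have r0 : density (U i) != 0 by rewrite gt_eqF.
  case: (momentum (U i)) (u' (node i)) => [m1 m2] [w1 w2].
  by rewrite /dot /= /GRing.scale /=; field.
(* The gas loses [tau * mu * X], and the magnetic energy gains [mu / 2] times [2 * tau * X]. *)
rewrite kin momE; move: magE; rewrite magE' => E.
have -> : L2inner M H' H' = L2inner M H H + 2 * (tau * X) by rewrite -E; field.
by field.
Qed.

Lemma source_divergence omega : Ph M omega ->
  L2inner M H' (grad omega) = L2inner M H (grad omega).
Proof.
move=> om; have [u' [Vu' hH' mom mag upd]] := hsrc.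
have [hG wG] := grad_Hh om; have := mag _ _ hG wG.
have mO := Omega_measurable M.
(* The weak curl of the test field is represented by 0, so the integrand on the right vanishes
   identically. *)
rewrite [X in _ * X](_ : _ = 0); last first.
  rewrite /L2inner /integral2 (@eq_Rintegral _ _ _ _ _ (cst 0)) ?Rintegral_cst ?mul0r //.
  by move=> x _; rewrite /cross_curl /dot /= !mulr0 oppr0 !mul0r addr0.
rewrite mulr0 => E; apply/eqP; rewrite -subr_eq0 -[X in _ == X]E; apply/eqP.
rewrite /L2inner /integral2 -RintegralB //.
- by apply: eq_Rintegral => x _; rewrite /dot /=; ring.
- by apply: L2inner_integrable; [exact: L1|exact: L2|exact: L1|exact: L2].
- by apply: L2inner_integrable; [exact: L1|exact: L2|exact: L1|exact: L2].
Qed.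

End Scheme.

(** * The full Strang step *)

Unset Implicit Arguments.
Set Strict Implicit.

Theorem proposition3p2 (R : realType) (M : periodic_mesh R)
    (phi : vtx M -> R * R -> R) (hphi : nodal_basis phi)
    (mu : R) (hmu : 0 < mu) (s : R -> R -> R)
    (eu : euler_update M)
    (hcons : euler_conservative phi eu) (hadm : euler_admissible eu)
    (U U' : vtx M -> state R) (H H' : R * R -> R * R)
    (hU : forall i, admissible (U i)) (hH : Hh M H)
    (hrun : mhd_update phi eu mu U H U' H') :
  [/\ \sum_i mass phi i * energy (U' i) + mu / 2 * L2inner M H' H' =
        \sum_i mass phi i * energy (U i) + mu / 2 * L2inner M H H,
      forall i, admissible (U' i),
      forall omega, Ph M omega ->
        L2inner M H' (grad omega) = L2inner M H (grad omega)
    & euler_entropy phi s eu ->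
      \sum_i mass phi i * entropy s (U' i) <=
        \sum_i mass phi i * entropy s (U i)].
Proof.
have [U1 [U2 [tau [run1 src run2]]]] := hrun.
have tau0 := euler_free_gt0 run1.
have r1 : euler_run eu U U1 by left; exists tau.
have r2 : euler_run eu U2 U' by right; exists tau.
have ad1 := hadm _ _ r1 hU.
(* Admissibility involves only density and internal energy, both fixed nodewise by the source
   step. *)
have ad2 i : admissible (U2 i).
  by rewrite /admissible (source_density src) (source_internal_energy src); exact: ad1.
split.
- have [_ _ ->] := hcons _ _ r2.
  rewrite (source_energy hphi hH src) => [|i]; last by have [] := ad1 i.
  by have [_ _ ->] := hcons _ _ r1.
- exact: hadm r2 ad2.
- move=> omega om; exact (source_divergence hH src om).
(* The entropy is likewise a function of density and internal energy, so the source step leaves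
   every summand unchanged between the two Euler inequalities. *)
- move=> ent; apply: le_trans (ent _ _ r2) _; apply: le_trans _ (ent _ _ r1).
  apply: ler_sum => i _.
  by rewrite /entropy (source_density src) (source_internal_energy src).
Qed.
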